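(* For all odd $k \ge 3$ and all $n \ge 4$, if $(k+1)/2$ does not divide $n-1$, then the number of pairwise non-isomorphic $n$-vertex $k$-minimal trees is between $n/(k+1)$ and $t(k^2)\cdot n$.
   Context: Graphs are finite and simple. A set $J \subseteq V(G)$ is a distance-$k$ independent set if any two distinct vertices of $J$ are at distance at least $k+1$; a $k$-MDIS is an inclusion-wise maximal distance-$k$ independent set. An $n$-vertex tree is $k$-minimal if it has the minimum possible number of $k$-MDISs among all $n$-vertex trees. $t(m)$ denotes the number of unlabeled $m$-vertex trees, i.e. the number of isomorphism classes of trees on $m$ vertices. *)

(* Defs.v *)
From mathcomp Require Import all_boot all_order all_fingroup all_algebra.

Set Implicit Arguments.
Unset Strict Implicit.
Unset Printing Implicit Defensive.

Section Graphs.

Variable T : finType.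

(* A simple graph on the vertex set T is given by its edge set, a set E of
   2-element subsets of T. *)
Implicit Types (E F : {set {set T}}) (J : {set T}).

Definition simple_graph E : bool := [forall e in E, #|e| == 2].

(* Irreflexive when E is simple, since [set x; x] is a singleton. *)
Definition adj E : rel T := fun x y => [set x; y] \in E.

Definition connected E : bool :=
  (0 < #|T|) && [forall x, forall y, connect (adj E) x y].

(* A cycle has pairwise distinct vertices, hence at most #|T| of them; the
   bound on d only serves to keep the definition boolean. *)
Definition acyclic E : bool :=
  ~~ [exists d : 'I_#|T|.+1, (2 < d) &&
       [exists c : d.-tuple T, ucycleb (adj E) c]].

Definition is_tree E : bool := [&& simple_graph E, connected E & acyclic E].

Definition has_walk E (d : nat) (x y : T) : bool :=
  [exists p : d.-tuple T, path (adj E) x p && (last x p == y)].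

(* The length of a shortest walk from x to y, which is less than #|T| if there
   is one; the junk value #|T| is returned otherwise. *)
Definition dist E (x y : T) : nat :=
  find (fun d => has_walk E d x y) (iota 0 #|T|).

(* The premise connect gives vertices in different components an infinite
   distance. *)
Definition dist_indep (k : nat) E J : bool :=
  [forall x in J, forall y in J,
     (x != y) ==> connect (adj E) x y ==> (k.+1 <= dist E x y)].

Definition mdis (k : nat) E J : bool := maxset (dist_indep k E) J.

Definition num_mdis (k : nat) E : nat := #|[set J | mdis k E J]|.

Definition k_minimal (k : nat) E : bool :=
  is_tree E && [forall F, is_tree F ==> (num_mdis k E <= num_mdis k F)].

Definition graph_iso E F : bool :=
  [exists s : {perm T}, F == [set s @: (e : {set T}) | e in E]].

Definition num_iso_classes (A : {set {set {set T}}}) : nat :=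
  #|equivalence_partition graph_iso A|.

End Graphs.

(* Every m-vertex graph is isomorphic to one with vertex set 'I_m, so
   isomorphism classes are counted there. *)
Definition num_trees (m : nat) : nat :=
  num_iso_classes [set E : {set {set 'I_m}} | is_tree E].

Definition num_k_minimal_trees (k n : nat) : nat :=
  num_iso_classes [set E : {set {set 'I_n}} | k_minimal k E].

(* Main.v *)
Require Import Defs.
From mathcomp Require Import all_boot all_order all_fingroup all_algebra.
From mathcomp Require Import zify.

(** Write [k.+1 = r + r] and [n - 1 = m * r + s] with [0 < s < r], and call two
    vertices far when their distance is at least [r + r].  The k-MDISs are the
    maximal sets of pairwise far vertices, and the minimum number of them is
    [min_mis r n], which is [n] when [n <= r] and [n - m + 1] otherwise.

    Lower bound for this number.  If no two vertices are far, the MDISs are the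
    singletons.  Otherwise let [x0] be an end of a longest path, which has
    length at least [r + r], and cut off the branch [S] that consists of the
    first [r] vertices of the path and of whatever hangs on them.  No two
    vertices of [S] are far, and a vertex outside [S] that is far from some
    vertex of [S] is far from [x0].  So every MDIS of the rest becomes an MDIS
    of the tree, after the addition of [x0] if that is possible, and these
    differ from the MDISs that meet [S] in a vertex other than [x0], of which
    there are at least [#|S| - 1] ([card_mis_prune], [card_touching]).  The
    bound follows by induction ([card_mis_convex]).

    Structure of the minimal trees, for [2 <= m].  Equality in this count forbids two
    distinct MDISs through the same vertex of [S] other than [x0], hence the
    vertices outside [S] at distance more than [r] from the attachment point
    of [S] are pairwise far ([branch_outside]).  This leaves no room beyond
    depth [r.+1]: a minimal tree has either one hub, with all vertices within
    distance [r], or two adjacent hubs, each with its own side of depth at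
    most [r] ([hub_structure_exists]).  The vertices at depth [r], one for each
    branch that reaches this depth, form an MDIS [B], and counting the MDISs
    against [B] shows that [B] has [m] elements.  Each of their branches has
    at least [r] vertices, so that all of them, up to [s] exceptions, are bare
    paths with [r] vertices, called legs.

    Upper bound.  Remove [m - s - 2] legs.  What remains is a tree, the base,
    with at most [k ^ 2] vertices, and its centre still is the set of the hubs
    ([minimal_decomposition]).  The tree is then determined by the isomorphism
    class of its base and by the number of legs to be put back at the first
    of the two hubs ([attach_iso]).  Since the number of trees is monotone in
    the number of vertices ([num_trees_le]), there are at most
    [num_trees (k ^ 2) * n] classes.  For [m <= 1] it is enough to count all
    trees, which have at most [k ^ 2] vertices.

    Lower bound for the number of classes.  Join the centre of a star with
    [s.+1] vertices to [p] legs and one of its leaves to [m - p] legs.  This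
    double broom is minimal: two vertices other than the ends of the legs are
    never far, so that an MDIS is either the set of these ends or determined
    by the only vertex that it has outside of this set.
    If [m <= 2 * p <= 2 * m], its maximum degree is [s + p], so that the
    [m./2.+1] admissible values of [p] give pairwise non-isomorphic trees, and
    [n <= m.+1 * r <= (k + 1) * m./2.+1]. *)

Set Implicit Arguments.
Unset Strict Implicit.
Unset Printing Implicit Defensive.

(** * Maximal independent sets of a symmetric relation *)

Section MaximalIndependentSets.

Variables (V : finType) (far : rel V).
Hypothesis farC : symmetric far.

Implicit Types (X S I J B D : {set V}) (x y z : V).

Definition indep J : bool :=
  [forall x in J, forall y in J, (x != y) ==> far x y].

Definition mis X : {set {set V}} :=
  [set J | maxset (fun J => (J \subset X) && indep J) J].

Lemma indepP J :
  reflect {in J &, forall x y, x != y -> far x y} (indep J).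
Proof.
apply: (iffP forall_inP) => [h x y xJ yJ xy|h x xJ].
  by move/forall_inP: (h x xJ) => /(_ y yJ) /implyP; apply.
by apply/forall_inP => y yJ; apply/implyP; apply: h.
Qed.

Lemma sub_indep I J : I \subset J -> indep J -> indep I.
Proof.
move=> sub /indepP h; apply/indepP => x y xI yI; apply: h; exact: (subsetP sub).
Qed.

Lemma indep1 x : indep [set x].
Proof. by apply/indepP => y z /set1P -> /set1P ->; rewrite eqxx. Qed.

Lemma indepU1 x J :
  indep J -> {in J, forall y, y != x -> far x y} -> indep (x |: J).
Proof.
move=> /indepP iJ xJ; apply/indepP => y z /setU1P[->|yJ] /setU1P[->|zJ] yz.
- by rewrite eqxx in yz.
- by apply: xJ; rewrite // eq_sym.
- by rewrite farC; apply: xJ.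
- exact: iJ.
Qed.

Lemma mis_sub X J : J \in mis X -> J \subset X.
Proof. by rewrite inE => /maxsetp /andP[]. Qed.

Lemma mis_indep X J : J \in mis X -> indep J.
Proof. by rewrite inE => /maxsetp /andP[]. Qed.

Lemma mis_far X J : J \in mis X -> {in J &, forall x y, x != y -> far x y}.
Proof. by move/mis_indep/indepP. Qed.

Lemma mis_max X J I :
  J \in mis X -> I \subset X -> indep I -> J \subset I -> I = J.
Proof.
rewrite inE => /maxsetP[_ h] IX iI JI; apply: h => //; exact/andP.
Qed.

Lemma mis_extend X I :
  I \subset X -> indep I -> exists2 J, J \in mis X & I \subset J.
Proof.
move=> IX iI.
have [|J mJ IJ] := @maxset_exists _ (fun J => (J \subset X) && indep J) I.
  by rewrite IX.
by exists J; rewrite // inE.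
Qed.

Lemma mis_maximal X J x : J \in mis X -> x \in X ->
  {in J, forall y, y != x -> far x y} -> x \in J.
Proof.
move=> mJ xX h; rewrite -(@mis_max X J (x |: J)) ?setU11 ?subsetU1 //.
  by rewrite subUset sub1set xX mis_sub.
exact: indepU1 (mis_indep mJ) h.
Qed.

Lemma misI X J : J \subset X -> indep J ->
  (forall x, x \in X -> {in J, forall y, y != x -> far x y} -> x \in J) ->
  J \in mis X.
Proof.
move=> JX iJ h; rewrite inE; apply/maxsetP; split; first exact/andP.
move=> I /andP[IX /indepP iI] JI; apply/eqP; rewrite eqEsubset JI andbT.
apply/subsetP => x xI; apply: h; first exact: (subsetP IX).
by move=> y yJ yx; apply: iI => //; rewrite ?(subsetP JI) // eq_sym.
Qed.

Lemma card_mis_ge X (W : {set V}) (F : V -> {set V}) :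
  {in W, forall x, F x \in mis X} -> {in W &, injective F} ->
  #|W| <= #|mis X|.
Proof.
move=> h inj; rewrite -(card_in_imset inj); apply: subset_leq_card.
by apply/subsetP => _ /imsetP[x xW ->]; apply: h.
Qed.

Lemma mis_through X x : x \in X -> exists2 J, J \in mis X & x \in J.
Proof.
move=> xX; have sX : [set x] \subset X by rewrite sub1set.
by have [J mJ] := mis_extend sX (indep1 x); rewrite sub1set => xJ; exists J.
Qed.

Lemma mis_through2 X x y : x \in X -> y \in X -> far x y ->
  exists J, [/\ J \in mis X, x \in J & y \in J].
Proof.
move=> xX yX xy; have sX : x |: [set y] \subset X.
  by rewrite subUset !sub1set xX.
have iJ : indep (x |: [set y]) by apply: indepU1 (indep1 y) _ => _ /set1P->.
have [J mJ /subsetP sJ] := mis_extend sX iJ.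
by exists J; rewrite mJ !sJ ?inE ?eqxx ?orbT.
Qed.

Lemma card_mis_close X : {in X &, forall x y, ~~ far x y} -> #|X| <= #|mis X|.
Proof.
move=> close; apply: (@card_mis_ge X X (fun x => [set x])) => [x xX|x y _ _].
  apply: misI; rewrite ?sub1set ?indep1 // => y yX /(_ x (set11 x)) h.
  by rewrite inE eq_sym; apply: contraTT (close y x yX xX) => xy; rewrite h.
by move/set1_inj.
Qed.

(** The counting step of the induction, in the form that only uses the relation:
    [S] is a set without far pairs, in which [x0] is the easiest vertex to add
    to an independent set of the rest. *)
Section Prune.

Variables (X S : {set V}) (x0 : V).
Hypotheses (SX : S \subset X) (x0S : x0 \in S).
Hypothesis Sclose : {in S &, forall x y, ~~ far x y}.
Hypothesis Sdom :
  forall x y, x \in S -> y \in X :\: S -> far x y -> far x0 y.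

Let touching := [set J in mis X | J :&: (S :\ x0) != set0].

Let lift_mis J := if indep (x0 |: J) then x0 |: J else J.

Let lift_misD J : J \subset X :\: S -> lift_mis J :\: S = J.
Proof.
move=> JX; have JS x : x \in J -> x \notin S.
  by move=> xJ; have := subsetP JX x xJ; rewrite inE => /andP[].
apply/setP => x; rewrite /lift_mis; case: ifP => _; rewrite !inE.
  have [->|_] := eqVneq x x0; first by rewrite x0S; case: (boolP (x0 \in J)) => [/JS|]; rewrite ?x0S.
  by rewrite /=; case: (boolP (x \in J)) => [/JS->|]; rewrite ?andbF.
by case: (boolP (x \in J)) => [/JS->|]; rewrite ?andbF.
Qed.

Let lift_mis_in J : J \in mis (X :\: S) -> lift_mis J \in mis X.
Proof.
move=> mJ; have JX := mis_sub mJ.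
have JX' : J \subset X by apply: subset_trans JX (subsetDl _ _).
have x0X := subsetP SX _ x0S.
have key x : x \in X -> {in J, forall y, y != x -> far x y} -> x \notin J ->
    x \in S /\ indep (x0 |: J).
  move=> xX h xJ; have xS : x \in S.
    by apply: contraR xJ => xS; apply: (mis_maximal mJ); rewrite // inE xS.
  split=> //; apply: indepU1; first exact: mis_indep mJ.
  move=> y yJ _; have yXS := subsetP JX _ yJ; apply: (Sdom xS) => //.
  apply: h => //; apply: contraTneq yXS => ->; by rewrite inE xS.
rewrite /lift_mis; case: ifP => iJ.
  apply: misI; rewrite ?subUset ?sub1set ?x0X // => x xX h.
  rewrite inE; apply/orP; case: (boolP (x \in J)) => xJ; [by right|left].
  have [xS _] := key x xX (fun y yJ => h y (setU1r _ yJ)) xJ.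
  rewrite inE eq_sym; apply: contraTT (Sclose xS x0S) => xx0.
  by rewrite h // setU11.
apply: misI => //; first exact: mis_indep mJ.
move=> x xX h; apply/contraT => xJ.
by have [_] := key x xX h xJ; rewrite iJ.
Qed.

(** A maximal independent set [J] of [X :\: S] extends to one of [X] that meets
    [S] at most in [x0]: if [x0] cannot be added, then no vertex of [S] can, by
    [Sdom].  The extension determines [J], and it is not in [touching]. *)
Lemma card_mis_prune : #|mis (X :\: S)| + #|touching| <= #|mis X|.
Proof.
have inj : {in mis (X :\: S) &, injective lift_mis}.
  move=> I J mI mJ eqIJ; rewrite -(lift_misD (mis_sub mI)) eqIJ.
  exact: lift_misD (mis_sub mJ).
rewrite -(card_in_imset inj) -cardsUI.
have -> : #|lift_mis @: mis (X :\: S) :&: touching| = 0.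
  apply/eqP; rewrite cards_eq0; apply/eqP/setP => J; rewrite !inE.
  apply/andP => -[/imsetP[I mI ->] /andP[_ /set0Pn[x]]].
  rewrite !inE => /and3P[xL xx0 xS]; move: xL; rewrite /lift_mis.
  have xI : x \notin I.
    by apply/negP => /(subsetP (mis_sub mI)); rewrite inE xS.
  by case: ifP => _; rewrite ?inE ?(negPf xI) ?(negPf xx0).
rewrite addn0; apply: subset_leq_card; rewrite subUset; apply/andP; split.
  by apply/subsetP => _ /imsetP[I mI ->]; apply: lift_mis_in.
by apply/subsetP => J; rewrite inE => /andP[].
Qed.

Let pickS J := odflt x0 [pick x in J :&: (S :\ x0)].

Let pickSP J x : J \in mis X -> x \in J -> x \in S -> x != x0 -> pickS J = x.
Proof.
move=> mJ xJ xS xx0; rewrite /pickS; case: pickP => [y|/(_ x)]; rewrite !inE.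
  case/and3P => yJ yx0 yS /=; apply/eqP/contraT => yx.
  by have := mis_far mJ yJ xJ yx; rewrite (negPf (Sclose _ _)).
by rewrite xJ xS xx0.
Qed.

Let touching_through J x :
  J \in mis X -> x \in J -> x \in S -> x != x0 -> J \in touching.
Proof.
move=> mJ xJ xS xx0; rewrite inE mJ; apply/set0Pn; exists x.
by rewrite !inE xJ xx0.
Qed.

(** An independent set has at most one vertex in [S], so that distinct vertices
    of [S] lie in distinct maximal independent sets. *)
Lemma card_touching : #|S|.-1 <= #|touching|.
Proof.
rewrite (cardsD1 x0 S) x0S /=.
apply: leq_trans (leq_imset_card pickS touching); apply: subset_leq_card.
apply/subsetP => x /setD1P[xx0 xS].
have [J mJ xJ] := mis_through (subsetP SX x xS).
apply/imsetP; exists J; first exact: touching_through xx0.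
by rewrite (pickSP mJ xJ).
Qed.

(** This is what equality in the induction excludes: a second maximal
    independent set through [x] adds one to the bound. *)
Lemma card_touching_two x I J : x \in S -> x != x0 -> I != J ->
  I \in mis X -> J \in mis X -> x \in I -> x \in J -> #|S| <= #|touching|.
Proof.
move=> xS xx0 IJ mI mJ xI xJ.
rewrite (cardsD1 I touching) (touching_through mI xI xS xx0) (cardsD1 x0 S) x0S.
rewrite leq_add2l; apply: leq_trans (leq_imset_card pickS _).
apply: subset_leq_card; apply/subsetP => y /setD1P[yx0 yS].
have [->|yx] := eqVneq y x.
  apply/imsetP; exists J; last by rewrite (pickSP mJ xJ).
  by rewrite in_setD1 (touching_through mJ xJ) // eq_sym IJ.
have [K mK yK] := mis_through (subsetP SX y yS).
apply/imsetP; exists K; last by rewrite (pickSP mK yK).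
rewrite in_setD1 (touching_through mK yK) // andbT.
apply: contraNneq (Sclose yS xS) => KI; apply: (mis_far mK) => //.
by rewrite KI.
Qed.

End Prune.

(** Each vertex [x] outside [B] is put in a maximal independent set that contains
    all the elements of [B] far from [x]; the separation hypothesis makes these
    sets distinct, and [B] itself is one more. *)
Lemma card_mis_ge_compl B : B \in mis setT ->
  (forall x y, x \notin B -> y \notin B -> x != y -> far x y ->
     exists2 b, b \in B & ~~ far x b && far y b) ->
  #|V| + 1 <= #|mis setT| + #|B|.
Proof.
move=> mB sep.
pose core x := x |: [set b in B | far x b].
have coreP x : exists2 J, J \in mis setT & core x \subset J.
  apply: mis_extend; rewrite ?subsetT //; apply: indepU1.
    by apply: sub_indep (mis_indep mB); apply/subsetP => b; rewrite inE => /andP[].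
  by move=> b; rewrite inE => /andP[].
pose F x := odflt set0 [pick J in mis setT | core x \subset J].
have FP x : F x \in mis setT /\ core x \subset F x.
  rewrite /F; case: pickP => [J /andP[]//|h].
  by have [J mJ cJ] := coreP x; have := h J; rewrite mJ cJ.
have xF x : x \in F x by rewrite (subsetP (FP x).2) // setU11.
rewrite -(cardsC B) -addnA addnC leq_add2r.
have inj : {in ~: B &, injective F}.
  move=> x y; rewrite !inE => xB yB eqF; apply/eqP/contraT => xy.
  have yx : y \in F x by rewrite eqF.
  have fxy := mis_far (FP x).1 (xF x) yx xy.
  have [b bB /andP[fxb fyb]] := sep x y xB yB xy fxy.
  have bF : b \in F x by rewrite eqF (subsetP (FP y).2) // !inE bB fyb orbT.
  have xb : x != b by apply: contraNneq xB => ->.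
  by rewrite (mis_far (FP x).1 (xF x) bF xb) in fxb.
rewrite addn1 -(card_in_imset inj) (cardsD1 B (mis setT)) mB add1n ltnS.
apply: subset_leq_card; apply/subsetP => _ /imsetP[x xB ->].
rewrite in_setD1 (FP x).1 andbT; apply: contraTneq (xF x) => ->.
by move: xB; rewrite inE.
Qed.

(** A maximal independent set has at most one vertex outside [D].  If this vertex
    is [x], the set consists of [x] and of all elements of [D] far from [x]; if
    there is none, the set is [D], which must then be nonempty. *)
Lemma card_mis_le_compl D : indep D ->
  {in ~: D &, forall x y, ~~ far x y} -> 0 < #|V| ->
  #|mis setT| + #|D| <= #|V| + (D != set0).
Proof.
move=> iD close V0.
pose G (o : option V) :=
  if o is Some x then x |: [set b in D | far x b] else D.
pose codes := [set Some x | x in ~: D] :|: (if D != set0 then [set None] else set0).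
have sub : mis setT \subset G @: codes.
  apply/subsetP => J mJ.
  case: (set_0Vmem (J :\: D)) => [JD|[x]]; last first.
    rewrite inE => /andP[xD xJ]; apply/imsetP; exists (Some x).
      by rewrite inE imset_f // inE.
    apply/setP => y; rewrite /= !inE; have [->//|yx] := eqVneq y x.
    apply/idP/andP => [yJ|[yD fxy]].
      have fyx := mis_far mJ yJ xJ yx; split; last by rewrite farC.
      by apply: contraTT fyx => yD; apply: close; rewrite inE.
    apply: (mis_maximal mJ); rewrite ?inE // => z zJ zy.
    have [->|zx] := eqVneq z x; first by rewrite farC.
    have fzx := mis_far mJ zJ xJ zx.
    have zD : z \in D by apply: contraTT fzx => zD; apply: close; rewrite inE.
    by move/indepP: iD; apply=> //; rewrite eq_sym.
  have JD' : J \subset D by rewrite -setD_eq0 JD.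
  have eqJ : D = J by apply: mis_max mJ _ iD JD'; rewrite subsetT.
  have D0 : D != set0.
    apply: contraTneq V0 => D0; rewrite -leqNgt leqn0; apply/eqP/eq_card0 => x.
    apply/negP => _; have : x \in J.
      apply: (mis_maximal mJ); rewrite ?inE // => y yJ _.
      by move: yJ; rewrite -eqJ D0 inE.
    by rewrite -eqJ D0 inE.
  by apply/imsetP; exists None; rewrite // /codes D0 !inE eqxx orbT.
apply: leq_trans (leq_add (leq_trans (subset_leq_card sub) (leq_imset_card _ _)) (leqnn _)) _.
rewrite -(cardsC D) [_ + #|~: D|]addnC addnAC leq_add2r.
apply: leq_trans (leq_card_setU _ _) _; apply: leq_add.
  by apply: leq_imset_card.
by case: ifP; rewrite ?cards1 ?cards0.
Qed.

End MaximalIndependentSets.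

(** * Tree metrics and the minimum number of maximal independent sets *)

(** Arithmetic on natural numbers after clearing the hypotheses of other kinds,
    whose preprocessing dominates the running time in large contexts. *)
Ltac nlia :=
  repeat match goal with
  | H : ?P |- _ =>
    lazymatch P with
    | is_true (leq _ _) => fail
    | @eq ?T _ _ => tryif unify T nat then fail else clear H
    | ~ (@eq ?T _ _) => tryif unify T nat then fail else clear H
    | or _ _ => fail
    | _ => clear H
    end
  end; lia.

(** For [r < n] this is [n - m + 1], where [m] is the quotient of [n.-1] by [r]. *)
Definition min_mis (r n : nat) : nat := n + (r < n) - n.-1 %/ r.

Lemma min_mis_small r n : n <= r -> min_mis r n = n.
Proof.
move=> nr; rewrite /min_mis ltnNge nr addn0 /=.
case: n nr => [|n] nr; first by rewrite div0n.
by rewrite divn_small ?subn0.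
Qed.

Lemma min_mis_leq r n : 0 < r -> min_mis r n <= n.
Proof.
move=> r0; rewrite /min_mis; case: ltnP => rn; last by rewrite addn0 leq_subr.
have : 0 < n.-1 %/ r by rewrite divn_gt0 //; lia.
lia.
Qed.

(** Adding [j >= r] vertices raises the quotient of [n.-1] by [r]; if [a <= r],
    the exceptional value at [a] is made up for by a quotient of at least 2. *)
Lemma min_mis_addl r a j : 0 < r -> r <= j -> 0 < a -> r.*2 < a + j ->
  min_mis r (a + j) < min_mis r a + j.
Proof.
move=> r0 rj a0 aj; have q2 : 2 <= (a + j).-1 %/ r by rewrite leq_divRL //; lia.
have qn : (a + j).-1 %/ r <= (a + j).-1 by apply: leq_div.
case: (leqP a r) => h; first by rewrite (min_mis_small h) /min_mis; lia.
rewrite /min_mis h; have -> : r < a + j by lia.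
have : a.-1 %/ r + 1 <= (a + j).-1 %/ r.
  by rewrite addnC -divnMDl // leq_div2r //; lia.
have : a.-1 %/ r <= a.-1 by apply: leq_div.
lia.
Qed.

(** All that the proof uses about the distances in a tree.  [tm_geo] makes the
    metric that of a connected graph, [tm_step] says that this graph is
    bipartite, and [tm_bridge] that each of its edges is a bridge. *)
Record tree_metric (V : finType) (d : V -> V -> nat) : Prop := TreeMetric {
  tm_eq0 : forall x y, (d x y == 0) = (x == y);
  tm_sym : forall x y, d x y = d y x;
  tm_tri : forall x y z, d x z <= d x y + d y z;
  tm_geo : forall x y i, i <= d x y ->
    exists z, d x z = i /\ d z y = d x y - i;
  tm_step : forall a c x, d a c = 1 -> d x c = (d x a).+1 \/ d x a = (d x c).+1;
  tm_bridge : forall a c x y, d a c = 1 -> d x c = (d x a).+1 ->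
    d y a = (d y c).+1 -> d x y = d x a + 1 + d c y }.

Section TreeMetricTheory.

Variables (V : finType) (d : V -> V -> nat).
Hypothesis dT : tree_metric d.

Implicit Types (X Y S : {set V}) (a c x y z : V).

Let dC x y : d x y = d y x. Proof. exact: tm_sym dT x y. Qed.
Let tri x y z : d x z <= d x y + d y z. Proof. exact: tm_tri dT x y z. Qed.

Lemma dxx x : d x x = 0.
Proof. by apply/eqP; rewrite (tm_eq0 dT). Qed.

Lemma d0_eq x y : d x y = 0 -> x = y.
Proof. by move/eqP; rewrite (tm_eq0 dT) => /eqP. Qed.

(** The component of [a] once the edge from [a] to [c] is deleted. *)
Definition side a c : {set V} := [set x | d x c == (d x a).+1].

(** For the metric of a tree, convex sets are the vertex sets of subtrees. *)
Definition convex X :=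
  forall x y z, x \in X -> y \in X -> d x z + d z y = d x y -> z \in X.

Lemma in_side a c x : (x \in side a c) = (d x c == (d x a).+1).
Proof. by rewrite inE. Qed.

Lemma sideC a c : d a c = 1 -> ~: side a c = side c a.
Proof.
move=> ac; apply/setP => x; rewrite !inE; have := tm_step dT x ac.
by case=> e; lia.
Qed.

Lemma notin_side a c x : d a c = 1 -> (x \notin side a c) = (x \in side c a).
Proof. by move=> ac; rewrite -(sideC ac) in_setC. Qed.

Lemma side_bridge a c x y : d a c = 1 -> x \in side a c -> y \in side c a ->
  d x y = d x a + 1 + d c y.
Proof. by rewrite !inE => ac /eqP xa /eqP yc; apply: (tm_bridge dT). Qed.

Lemma side_l a c : d a c = 1 -> a \in side a c.
Proof. by rewrite inE dxx => ->. Qed.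

Lemma side_r a c : d a c = 1 -> c \in side c a.
Proof. by move=> ac; apply: side_l; rewrite dC. Qed.

Lemma side_convex a c : d a c = 1 -> convex (side a c).
Proof.
move=> ac x y z xS yS xzy; apply/contraT; rewrite notin_side // => zS.
have xz := side_bridge ac xS zS; have yz := side_bridge ac yS zS.
have := tri x a y; have := dC z y; have := dC c z; have := dC y a; lia.
Qed.

Lemma convexI X Y : convex X -> convex Y -> convex (X :&: Y).
Proof.
move=> cX cY x y z /setIP[xX xY] /setIP[yX yY] e.
by rewrite inE (cX x y) // (cY x y).
Qed.

Lemma convexT : convex setT.
Proof. by move=> x y z _ _ _; rewrite inE. Qed.

Lemma geodesic x y i : i <= d x y ->
  exists z, [/\ d x z = i, d z y = d x y - i & d x z + d z y = d x y].
Proof.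
by move=> h; have [z [e1 e2]] := tm_geo dT h; exists z; split => //; lia.
Qed.

Lemma card_geodesic X x y : convex X -> x \in X -> y \in X -> d x y < #|X|.
Proof.
move=> cX xX yX.
have F i : exists z, i < (d x y).+1 -> z \in X /\ d x z = i.
  case: (ltnP i (d x y).+1) => h; last by exists x.
  have [z [e1 _ e3]] := geodesic (h : i <= d x y).
  by exists z => _; split => //; apply: (cX x y).
have /fin_all_exists[f fP] (i : 'I_(d x y).+1) :
    exists z, z \in X /\ d x z = i.
  by have [z /(_ (ltn_ord i))] := F i; exists z.
have inj : injective f.
  move=> i j eqf; apply: val_inj => /=.
  by rewrite -(fP i).2 -(fP j).2 eqf.
rewrite -[X in X <= _](card_ord) -(card_imset _ inj); apply: subset_leq_card.
by apply/subsetP => _ /imsetP[i _ ->]; case: (fP i).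
Qed.

Lemma diametral_pair X : X != set0 -> exists x0 x',
  [/\ x0 \in X, x' \in X & {in X &, forall x y, d x y <= d x0 x'}].
Proof.
case/set0Pn => x xX.
have xxX : (x, x) \in setX X X by rewrite !inE xX.
case: (arg_maxnP (fun z : V * V => d z.1 z.2) xxX).
move=> [x0 x'] /= /setXP[/= x0X x'X] dmax; exists x0, x'; split=> //.
by move=> y z yX zX; apply: (dmax (y, z)); apply/setXP.
Qed.

Section Radius.

Variable r : nat.
Hypothesis r2 : 2 <= r.

Definition far x y := r + r <= d x y.

Lemma farC : symmetric far.
Proof. by move=> x y; rewrite /far dC. Qed.

(** The part of [X] beyond the edge from [c] to [a], when its vertices have depth
    at most [r.-1] and [x0] attains this depth. *)
Definition deep_branch X a c x0 :=
  [/\ d a c = 1, a \in X, x0 \in X :&: side a c, d x0 a = r.-1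
    & {in X :&: side a c, forall x, d x a <= r.-1}].

Section Branch.

Variables (X : {set V}) (a c x0 : V).
Hypothesis (br : deep_branch X a c x0).

Let S := X :&: side a c.

Lemma branch_close : {in S &, forall x y, ~~ far x y}.
Proof.
case: br => _ _ _ _ h x y /h xa /h ya.
by rewrite /far -ltnNge; have := tri x a y; rewrite (dC a y); lia.
Qed.

(** The vertex [x0] is the deepest of the branch, hence the farthest from any
    vertex outside. *)
Lemma branch_dom x y : x \in S -> y \in X :\: S -> far x y -> far x0 y.
Proof.
case: br => ac aX x0S x0a h xS; rewrite !inE => /andP[].
case: (boolP (y \in X)) => //= yX; rewrite -in_side (notin_side _ ac) => yc _.
have ey := side_bridge ac (proj2 (setIP xS)) yc.
have ex := side_bridge ac (proj2 (setIP x0S)) yc.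
by rewrite /far ex ey x0a; have := h x xS; lia.
Qed.

Lemma branch_card : convex X -> r <= #|S|.
Proof.
case: br => ac aX x0S x0a h cX; suff : d x0 a < #|S| by rewrite x0a; lia.
apply: card_geodesic => //; first exact: convexI cX (side_convex ac).
by rewrite inE aX side_l.
Qed.

Lemma branch_rest_convex : convex X -> convex (X :\: S).
Proof.
case: br => ac _ _ _ _ cX; have -> : X :\: S = X :&: side c a.
  by apply/setP => x; rewrite -(sideC ac) in_setD !in_setI in_setC; case: (x \in X); rewrite ?andbT ?andbF ?andFb.
by apply: convexI cX (side_convex _); rewrite dC.
Qed.

Lemma branch_prune : #|mis far (X :\: S)| +
  #|[set J in mis far X | J :&: (S :\ x0) != set0]| <= #|mis far X|.
Proof.
case: (br) => _ _ x0S _ _; apply: card_mis_prune => //; first exact: farC.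
- exact: subsetIl.
- exact: branch_close.
- exact: branch_dom.
Qed.

End Branch.

(** Since no path is longer than the one from [x0] to [x'], nothing in the branch
    of its first [r] vertices is deeper than [x0]. *)
Lemma diametral_branch X x0 x' : convex X -> x0 \in X -> x' \in X ->
    {in X &, forall x y, d x y <= d x0 x'} -> r + r <= d x0 x' ->
  exists a c, [/\ deep_branch X a c x0, c \in X,
    d x0 c = r & x' \in side c a].
Proof.
move=> cX x0X x'X dmax dr.
have [|a [ea1 ea2 ea3]] := @geodesic x0 x' r.-1; first lia.
have [|c [ec1 ec2 ec3]] := @geodesic a x' 1; first lia.
have aX : a \in X by apply: cX ea3.
have cX' : c \in X by apply: cX ec3.
have x0c : d x0 c = r.
  by have := tri x0 a c; have := tri x0 c x'; lia.
have x0S : x0 \in side a c by rewrite inE ea1 x0c; lia.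
have x'S : x' \in side c a by rewrite inE (dC x' a) (dC x' c); lia.
exists a, c; split=> //; split=> //; first by rewrite inE x0X.
move=> x /setIP[xX xS]; have := side_bridge ec1 xS x'S.
by have := dmax x x' xX x'X; lia.
Qed.

(** The induction runs over the convex subsets of a fixed tree, so that pruning
    a branch does not change the ambient metric. *)
Lemma card_mis_convex X :
  convex X -> X != set0 -> min_mis r #|X| <= #|mis far X|.
Proof.
have [n] := ubnP #|X|; elim: n X => // n IHn X Xn cX /set0Pn[x xX].
have [|x0 [x' [x0X x'X dmax']]] := @diametral_pair X.
  by apply/set0Pn; exists x.
case: (ltnP (d x0 x') (r + r)) => dr.
  apply: leq_trans (min_mis_leq _ _) (card_mis_close _); first lia.
  by move=> y z yX zX; rewrite /far -ltnNge; have := dmax' y z yX zX; lia.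
have [a [c [br cX' x0c x'S]]] := diametral_branch cX x0X x'X dmax' dr.
pose S := X :&: side a c.
have [ac aX x0S x0a h] := br.
have SX : #|X :\: S| + #|S| = #|X|.
  by rewrite addnC -(cardsID S X) (setIidPr _) // subsetIl.
have S1 : r <= #|S| := branch_card br cX.
have cXS : c \in X :\: S.
  by rewrite in_setD cX' /S in_setI cX' /= (notin_side _ ac) side_r.
have XS0 : 0 < #|X :\: S| by apply/card_gt0P; exists c.
have Xr : r.*2 < #|X| by have := card_geodesic cX x0X x'X; lia.
have le3 : min_mis r #|X :\: S| <= #|mis far (X :\: S)|.
  apply: IHn (branch_rest_convex br cX) _; rewrite -/S; first lia.
  by rewrite -card_gt0.
have le1 := branch_prune br.
have le2 := card_touching (subsetIl X (side a c)) x0S (branch_close br).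
rewrite -/S in le1 le2.
have lt : min_mis r #|X| < min_mis r #|X :\: S| + #|S|.
  by rewrite -SX; apply: min_mis_addl; rewrite ?SX //; apply: ltnW.
have S0 : 0 < #|S| by apply: leq_trans S1; apply: ltnW.
rewrite -ltnS; apply: leq_trans lt _; rewrite -(prednK S0) addnS ltnS.
exact: leq_trans (leq_add le3 le2) le1.
Qed.

End Radius.

End TreeMetricTheory.

(** * The distance function of a tree *)

Section GraphDistance.

Variables (T : finType) (E : {set {set T}}).
Implicit Types (x y z a c : T) (p : seq T).

Lemma adjC : symmetric (adj E).
Proof. by move=> x y; rewrite /adj setUC. Qed.

Lemma adj_neq x y : simple_graph E -> adj E x y -> x != y.
Proof. by move=> /forall_inP sE xy; have := sE _ xy; rewrite cards2; case: (x == y). Qed.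

Lemma has_walkP n x y :
  reflect (exists p, [/\ size p = n, path (adj E) x p & last x p = y])
          (has_walk E n x y).
Proof.
apply: (iffP existsP) => [[p /andP[pp /eqP lp]]|[p [sp pp lp]]].
  by exists p; rewrite size_tuple.
by move/eqP: sp => sp; exists (Tuple sp); rewrite /= pp lp eqxx.
Qed.

Lemma dist_le x p : path (adj E) x p -> dist E x (last x p) <= size p.
Proof.
move=> pp; rewrite /dist; case: (ltnP (size p) #|T|) => sT; last first.
  by apply: leq_trans sT; rewrite -[X in _ <= X](size_iota 0) find_size.
rewrite leqNgt; apply/negP => /(before_find 0).
by rewrite nth_iota // add0n => /negbT/has_walkP[]; exists p.
Qed.

(** A path without repetitions has fewer than [#|T|] edges, so the search that
    defines [dist] meets a shortest walk. *)
Lemma dist_path x y : connect (adj E) x y ->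
  exists p, [/\ size p = dist E x y, path (adj E) x p & last x p = y].
Proof.
case/connectP => p0 /shortenP[p pp up _] yE.
have h : has (fun n => has_walk E n x y) (iota 0 #|T|).
  apply/hasP; exists (size p); last by apply/has_walkP; exists p.
  by rewrite mem_iota add0n -[_.+1]/(size (x :: p)) -(card_uniqP up) max_card.
apply/has_walkP; have := nth_find 0 h.
by rewrite nth_iota //; move: h; rewrite has_find size_iota.
Qed.

Section Tree.

Hypothesis tE : is_tree E.

Let sE : simple_graph E. Proof. by case/and3P: tE. Qed.

Lemma tree_connect x y : connect (adj E) x y.
Proof. by case/and3P: tE => _ /andP[_ /forallP/(_ x)/forallP/(_ y)]. Qed.

Let dpath x y := dist_path (tree_connect x y).

Lemma dist_sym x y : dist E x y = dist E y x.
Proof.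
suff h u v : dist E u v <= dist E v u by apply/eqP; rewrite eqn_leq !h.
have [p [<- pp pl]] := dpath v u.
have := @dist_le (last v p) (rev (belast v p)).
rewrite rev_path (eq_path (e' := adj E)) ?pl ?size_rev ?size_belast; last first.
  by move=> a b; apply: adjC.
move=> /(_ pp); suff -> : last u (rev (belast v p)) = v by [].
by case: p pp pl => [|z p] //= _ _; rewrite rev_cons last_rcons.
Qed.

Lemma dist_tri x y z : dist E x z <= dist E x y + dist E y z.
Proof.
have [p [<- pp pl]] := dpath x y; have [q [<- pq ql]] := dpath y z.
by rewrite -size_cat -ql -pl -last_cat dist_le // cat_path pp pl.
Qed.

Lemma dist_eq0 x y : (dist E x y == 0) = (x == y).
Proof.
apply/eqP/eqP => [|<-]; last by apply/eqP; rewrite -leqn0 (@dist_le x [::]).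
by have [[|z p] [<- _ pl]] := dpath x y.
Qed.

Lemma dist_geo x y i : i <= dist E x y ->
  exists z, dist E x z = i /\ dist E z y = dist E x y - i.
Proof.
have [p [sp pp pl]] := dpath x y; rewrite -sp => ip.
move: pp pl; rewrite -{1 2}(cat_take_drop i p) cat_path last_cat => /andP[p1 p2] pl.
exists (last x (take i p)).
have := dist_le p1; have := dist_le p2; rewrite pl size_drop size_takel //.
by have := dist_tri x (last x (take i p)) y; rewrite -sp; lia.
Qed.

Lemma dist1E x y : (dist E x y == 1) = adj E x y.
Proof.
apply/eqP/idP => [|xy].
  by have [[|z [|w p]] [<- //= + <-]] := dpath x y; rewrite andbT.
have := @dist_le x [:: y]; rewrite /= xy => /(_ isT).
by have := dist_eq0 x y; rewrite (negPf (adj_neq sE xy)); lia.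
Qed.

Lemma path_leaves (e : rel T) (P : pred T) x p :
  path e x p -> P x -> ~~ P (last x p) ->
  exists p1 z p2, [/\ p = p1 ++ z :: p2, P (last x p1) & ~~ P z].
Proof.
elim: p x => [|y p IHp] x /=; first by move=> _ ->.
case/andP=> xy pp Px Pl; case: (boolP (P y)) => Py; last by exists [::], y, p.
by have [p1 [z [p2 [-> ? ?]]]] := IHp y pp Py Pl; exists (y :: p1), z, p2.
Qed.

(** Deleting the edge from [a] to [c] disconnects [a] from [c], since a path without
    repetitions that joins them otherwise closes up to a cycle.  A walk between
    the two components therefore crosses this edge. *)
Section Bridge.

Variables a c : T.
Hypothesis ac : adj E a c.

Let e' x y := adj E x y && ([set x; y] != [set a; c]).

Let bridge : ~~ connect e' a c.
Proof.
apply/connectP => -[p0 /shortenP[p pp up _] cE].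
have : path (adj E) a p by apply: sub_path pp => x y /andP[].
case/and3P: tE => _ _ /negP + pp'; apply; apply/existsP.
have sp : size (a :: p) < #|T|.+1.
  by rewrite ltnS -(card_uniqP up) max_card.
exists (Ordinal sp); apply/andP; split.
  rewrite /=; case: p pp cE {up pp' sp} => [|y [|z p]] //=.
    by move=> _ cE; have := adj_neq sE ac; rewrite cE eqxx.
  by rewrite /e' => + yE; rewrite -yE eqxx !andbF.
apply/existsP; exists (in_tuple (a :: p)).
by rewrite /ucycleb /= rcons_path pp' -cE adjC ac.
Qed.

Let P z := connect e' a z.

Let cross x y : P x -> ~~ P y -> dist E x a + 1 + dist E c y <= dist E x y.
Proof.
move=> Px Py; have [p [<- pp pl]] := dpath x y.
have [|p1 [z [p2 [pE Pz1 Pz]]]] := @path_leaves _ P x p pp Px; first by rewrite pl.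
move: pp pl; rewrite pE cat_path last_cat /= => /and3P[pp1 z1z pp2] pl.
have : [set last x p1; z] = [set a; c].
  apply/eqP; apply: contraR Pz => h; apply: connect_trans Pz1 (connect1 _).
  by rewrite /e' z1z.
move=> eqS; have aS : a \in [set last x p1; z] by rewrite eqS set21.
have cS : c \in [set last x p1; z] by rewrite eqS set22.
have aE : a = last x p1.
  by case/set2P: aS => // aE; move: Pz; rewrite -aE /P connect0.
have cE : c = z.
  by case/set2P: cS => // cE; move: bridge; rewrite cE; move/negP; case.
move: (dist_le pp1) (dist_le pp2); rewrite pl size_cat /= -aE -cE.
clear; lia.
Qed.

Lemma dist_bridge_step x :
  dist E x c = (dist E x a).+1 \/ dist E x a = (dist E x c).+1.
Proof.
have tri := dist_tri; have C := dist_sym.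
have ac1 : dist E a c = 1 by apply/eqP; rewrite dist1E.
have aa z : dist E z z = 0 by apply/eqP; rewrite dist_eq0.
case: (boolP (P x)) => Px; [left|right].
  by have := cross Px bridge; rewrite aa; have := tri x a c; lia.
have := cross (connect0 _ a : P a) Px; rewrite aa (C a x) (C c x).
by have := tri x c a; rewrite (C c a); lia.
Qed.

Lemma dist_bridge x y :
    dist E x c = (dist E x a).+1 -> dist E y a = (dist E y c).+1 ->
  dist E x y = dist E x a + 1 + dist E c y.
Proof.
have tri := dist_tri; have C := dist_sym.
have ac1 : dist E a c = 1 by apply/eqP; rewrite dist1E.
have aa z : dist E z z = 0 by apply/eqP; rewrite dist_eq0.
move=> xE yE; have Px : P x.
  apply/negPn/negP => Px; have := cross (connect0 _ a : P a) Px.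
  by rewrite aa (C a x) (C c x); lia.
have Py : ~~ P y by apply/negP => Py; have := cross Py bridge; lia.
have := cross Px Py; have := tri x a y; have := tri a c y; lia.
Qed.

End Bridge.

Lemma tree_metric_dist : tree_metric (dist E).
Proof.
split; [exact: dist_eq0|exact: dist_sym|exact: dist_tri|exact: dist_geo| |].
  by move=> a c x /eqP; rewrite dist1E => ac; apply: dist_bridge_step.
by move=> a c x y /eqP; rewrite dist1E => ac; apply: dist_bridge.
Qed.

(** In a tree every two vertices are connected, and the distance condition
    [k.+1 <= dist E x y] is that of [far]. *)
Lemma num_mdisE k r : k.+1 = r + r ->
  num_mdis k E = #|mis (far (dist E) r) setT|.
Proof.
move=> kr; apply: eq_card => J; rewrite !inE /mdis; apply: maxset_eq => {}J.
rewrite subsetT /dist_indep /indep; apply: eq_forallb_in => x _.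
by apply: eq_forallb_in => y _; rewrite tree_connect /far kr.
Qed.

Lemma num_mdis_ge k r : 2 <= r -> k.+1 = r + r -> min_mis r #|T| <= num_mdis k E.
Proof.
move=> r2 kr; rewrite (num_mdisE kr) -[#|T|]cardsT.
apply: (card_mis_convex tree_metric_dist r2) => [x y z _ _ _|].
  by rewrite inE.
by rewrite -card_gt0 cardsT; case/and3P: tE => _ /andP[].
Qed.

End Tree.

End GraphDistance.

(** * The hubs of a minimal tree *)

(** The common shape of the two kinds of minimal trees: [u = v] if there is one
    hub, and [u], [v] are adjacent if there are two.  [B] contains one vertex at
    depth [r] for each branch that reaches this depth, [root b] is the hub at
    which the branch of [b] hangs, and [b1], [b2] are two elements of [B] at
    the largest possible distance. *)
Record hub_structure (V : finType) (d : V -> V -> nat) (r : nat)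
    (u v : V) (B : {set V}) (root : V -> V) (b1 b2 : V) : Prop := {
  hub_close : d u v <= 1;
  hub_root : forall b, b \in B ->
    (root b = u /\ d b v = r + d u v) \/ (root b = v /\ d b u = r + d u v);
  hub_depth : forall b, b \in B -> d b (root b) = r;
  hub_ecc : forall x, d x u <= r + d u v /\ d x v <= r + d u v;
  hub_far : {in B &, forall b b', b != b' -> far d r b b'};
  hub_card : #|V| + 1 <= #|mis (far d r) setT| + #|B|;
  hub_ends : [/\ b1 \in B, b2 \in B, root b1 = u, root b2 = v
    & d b1 b2 = r + r + d u v] }.

Section Minimal.

Variables (V : finType) (d : V -> V -> nat) (r : nat).
Hypotheses (dT : tree_metric d) (r2 : 2 <= r).
Hypothesis V_large : r.*2 < #|V|.
Hypothesis V_min : #|mis (far d r) setT| <= min_mis r #|V|.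

Implicit Types (a c x y z : V).

Let dC x y : d x y = d y x. Proof. exact: tm_sym dT x y. Qed.
Let tri x y z : d x z <= d x y + d y z. Proof. exact: tm_tri dT x y z. Qed.
Let sfar := farC dT r.

(** Otherwise take the vertex [x1] of the branch at depth [r.-2].  It is far from [y]
    and from [z], and it lies in two distinct maximal independent sets, one
    through [y] and one through [z]: too many for a minimal tree. *)
Lemma branch_outside a c x0 y z : deep_branch d r setT a c x0 ->
    y \notin side d a c -> z \notin side d a c -> r < d y c -> r < d z c ->
  y != z -> far d r y z.
Proof.
move=> br yS zS yr zr yz; apply/contraT => nyz.
have [ac _ + x0a h] := br; rewrite setTI => x0S.
have [|x1 [x1a x10 e]] := @geodesic _ _ dT a x0 r.-2; first by rewrite dC; nlia.
have x1S : x1 \in side d a c.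
  by apply: (side_convex dT ac (side_l dT ac) x0S).
have x1x0 : x1 != x0.
  by apply: contraTneq isT => E; move: x10; rewrite E (dxx dT) dC x0a; nlia.
have x1far w : w \notin side d a c -> r < d w c -> far d r x1 w.
  rewrite (notin_side dT _ ac) => wS wr.
  by rewrite /far (side_bridge dT ac x1S wS) (dC x1 a) x1a (dC c w); nlia.
have ext w : w \notin side d a c -> r < d w c ->
    exists J, [/\ J \in mis (far d r) setT, x1 \in J & w \in J].
  by move=> wS wr; apply: mis_through2; rewrite ?inE //; apply: x1far.
have [I [mI x1I yI]] := ext y yS yr; have [J [mJ x1J zJ]] := ext z zS zr.
have IJ : I != J.
  by apply: contraNneq nyz => IJ; apply: (mis_far mI); rewrite // IJ.
have le1 := branch_prune dT r2 br.
have := branch_close dT r2 br; have := branch_card dT r2 br (@convexT _ d).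
have := card_mis_convex dT r2 (branch_rest_convex dT br (@convexT _ d)).
move: le1; rewrite setTI => le1 le3 le4 close.
have le2 := card_touching_two (subsetT _) x0S close x1S x1x0 IJ mI mJ x1I x1J.
have cS : c \in setT :\: side d a c.
  by rewrite !inE (dxx dT) dC ac.
have {}le3 := le3 (introT (set0Pn _) (ex_intro _ c cS)).
have XS : #|[set: V] :\: side d a c| + #|side d a c| = #|V|.
  by rewrite setTD addnC cardsC.
have Sn : 0 < #|[set: V] :\: side d a c| by apply/card_gt0P; exists c.
have lt : min_mis r #|V| < min_mis r #|[set: V] :\: side d a c| + #|side d a c|.
  by rewrite -XS; apply: min_mis_addl; rewrite ?XS //; apply: ltnW.
have := leq_trans lt (leq_trans (leq_add le3 le2) le1).
by rewrite ltnNge V_min.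
Qed.

(** A deeper vertex and its neighbour towards [c] would be far from each other. *)
Lemma branch_depth a c x0 y : deep_branch d r setT a c x0 ->
  y \notin side d a c -> d y c <= r.+1.
Proof.
move=> br yS; rewrite leqNgt; apply/negP => yr.
have [ac _ _ _ _] := br; have ca : d c a = 1 by rewrite dC.
have [|z [yz zc e]] := @geodesic _ _ dT y c 1; first nlia.
have zS : z \notin side d a c.
  rewrite (notin_side dT _ ac); apply: (side_convex dT ca _ _ e).
    by rewrite -(notin_side dT _ ac).
  exact: side_r.
have yz' : y != z by apply: contraTneq isT => E; move: yz; rewrite E (dxx dT).
have := branch_outside br yS zS _ _ yz'; rewrite /far yz zc; nlia.
Qed.

(** For elements of depth [r], not being far means lying in the same branch at [c].
    This is a transitive relation, which gives the separation required by
    [card_mis_ge_compl]. *)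
Lemma hub_structure_one a c x0 x' : deep_branch d r setT a c x0 ->
    x' \in side d c a -> r + r <= d x0 x' -> (forall x, d x c <= r) ->
  exists B, hub_structure d r c c B (fun=> c) x0 x'.
Proof.
move=> br x'S dr ecc; have [ac _ + x0a _] := br; rewrite setTI => x0S.
have x0c : d x0 c = r by move: x0S; rewrite inE => /eqP->; nlia.
have x'c : d x' c = r by have := tri x0 c x'; have := ecc x'; rewrite (dC x' c); nlia.
have x0x' : x0 != x' by apply: contraTneq dr => ->; rewrite (dxx dT); nlia.
have [B [mB x0B x'B]] := mis_through2 sfar (in_setT x0) (in_setT x') dr.
have deep x y : far d r x y -> d x c = r.
  by rewrite /far; have := tri x c y; have := ecc x; have := ecc y; rewrite (dC c y); nlia.
have Bdeep b : b \in B -> d b c = r.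
  move=> bB; have [->//|bx0] := eqVneq b x0.
  exact: deep (mis_far mB bB x0B bx0).
exists B; split; rewrite ?(dxx dT) ?addn0 //.
- by move=> b /Bdeep; left.
- exact: mis_far mB.
- apply: card_mis_ge_compl => // x y xB yB xy fxy.
  have [b bB nxb] : exists2 b, b \in B & ~~ far d r x b.
    apply/exists_inP; apply: contraR xB; rewrite negb_exists_in.
    move/forall_inP => h; apply: (mis_maximal sfar mB); rewrite ?inE // => b bB _.
    by have := h b bB; rewrite negbK.
  exists b => //; rewrite nxb /=; apply/contraT => nyb.
  have bc := Bdeep b bB; have xc := deep _ _ fxy.
  have yc : d y c = r by apply: (deep y x); rewrite sfar.
  have [|e [ce eb e3]] := @geodesic _ _ dT c b 1; first by rewrite dC bc; nlia.
  have ec : d e c = 1 by rewrite dC.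
  have bS : b \in side d e c by rewrite inE bc (dC b e) eb dC bc; nlia.
  have near z : ~~ far d r z b -> d z c = r -> d z e = r.-1.
    move=> nzb zc; have : z \in side d e c.
      apply: contraR nzb; rewrite (notin_side dT _ ec) => zS.
      have ce' : d c e = 1 by [].
      by rewrite /far (side_bridge dT ce' zS bS) zc eb dC bc; nlia.
    by rewrite inE zc => /eqP->; nlia.
  move: fxy; rewrite /far; have := tri x e y; rewrite (dC e y) near // near //; nlia.
- by split=> //; have := tri x0 c x'; rewrite (dC c x'); nlia.
Qed.

(** The branch towards [w] at the neighbour [v] of [c] is deep too, and
    [branch_outside] applied to each of the two deep branches controls the side
    of the other hub.  Vertices of depth less than [r] are then never far from each
    other, on whatever sides they lie. *)
Lemma hub_structure_two a c x0 w : deep_branch d r setT a c x0 ->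
    w \notin side d a c -> d w c = r.+1 ->
  exists v B root, hub_structure d r c v B root x0 w.
Proof.
move=> br wS wc; have [ac _ + x0a hS] := br; rewrite setTI => x0S.
have x0c : d x0 c = r by move: x0S; rewrite inE => /eqP->; nlia.
have [|v [cv vw _]] := @geodesic _ _ dT c w 1; first by rewrite dC wc.
have {}vw : d v w = r by rewrite vw dC wc; nlia.
have [|a2 [va2 a2w _]] := @geodesic _ _ dT v w 1; first by rewrite vw; nlia.
have {}a2w : d a2 w = r.-1 by rewrite a2w vw; nlia.
have a2v : d a2 v = 1 by rewrite dC.
have vc : d v c = 1 by rewrite dC.
have ca : d c a = 1 by rewrite dC.
have wv : w \in side d v c by rewrite inE (dC w v) vw wc.
have wa2 : w \in side d a2 v by rewrite inE (dC w v) vw (dC w a2) a2w; nlia.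
have ca2 : d c a2 = 2.
  by apply/eqP; rewrite eqn_leq; have := tri c v a2; have := tri c a2 w; rewrite (dC c w); nlia.
have S2v x : x \in side d a2 v -> d x c = (d x a2).+2.
  move=> xS; rewrite (side_bridge dT a2v xS _) ?vc; first nlia.
  by rewrite inE ca2 cv.
have vS : v \notin side d a c.
  rewrite inE vc; apply/eqP => -[/esym/(d0_eq dT) va].
  have : w \in side d c a by rewrite -(notin_side dT).
  by rewrite inE wc -va (dC w v) vw => /eqP; nlia.
have va : d v a = 2.
  move: vS; rewrite (notin_side dT _ ac) inE vc => /eqP; nlia.
have SU x : x \in side d a c -> d x v = (d x c).+1.
  move=> xS; rewrite (side_bridge dT ac xS) ?cv; last by rewrite -(notin_side dT).
  by move: xS; rewrite inE => /eqP->; nlia.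
have br2 : deep_branch d r setT a2 v w.
  split; [by []|by []|by rewrite setTI|by rewrite dC|].
  move=> x /setIP[_ xS].
  have xc := S2v x xS.
  have xS' : x \notin side d a c.
    apply/negP => /SU; have : d x v = (d x a2).+1 by move: xS; rewrite inE => /eqP.
    by nlia.
  by have := branch_depth br xS'; nlia.
have notS x : x \in side d v c -> x \notin side d a c.
  by rewrite inE => /eqP xv; apply/negP => /SU; nlia.
have notS2 x : x \in side d c v -> x \notin side d a2 v.
  rewrite inE => /eqP xc; rewrite inE; apply/negP => xa2.
  by have := S2v x; rewrite inE xa2 => /(_ isT); move/eqP: xa2; nlia.
have depc x : x \in side d c v -> d x c <= r.
  move=> xS; have := branch_depth br2 (notS2 x xS).
  by move: xS; rewrite inE => /eqP->; nlia.
have depv x : x \in side d v c -> d x v <= r.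
  move=> xS; have := branch_depth br (notS x xS).
  by move: xS; rewrite inE => /eqP->; nlia.
pose root x := if x \in side d c v then c else v.
pose h x := d x (root x).
pose B := [set x | h x == r].
have hr x : h x <= r.
  rewrite /h /root; case: ifP => [/depc//|/negbT].
  by rewrite (notin_side dT _ cv) => /depv.
have rootP x : (root x = c /\ d x v = (h x).+1) \/ (root x = v /\ d x c = (h x).+1).
  rewrite /h /root; case: ifP => [|/negbT]; first by rewrite inE => /eqP; left.
  by rewrite (notin_side dT _ cv) inE => /eqP; right.
have cross x y : root x != root y -> d x y = h x + 1 + h y.
  have other z : z \in side d c v = false -> z \in side d v c.
    by move=> zS; rewrite -(notin_side dT _ cv) zS.
  rewrite /h /root; case xS: (x \in side d c v); case yS: (y \in side d c v);
    rewrite ?eqxx // => _.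
    by rewrite (side_bridge dT cv xS (other y yS)) (dC v y).
  by rewrite (side_bridge dT vc (other x xS) yS) (dC c y).
have cNv : c != v by apply: contraTneq isT => E; move: cv; rewrite E (dxx dT).
have vNc : v != c by rewrite eq_sym.
have near x y : d x y <= h x + h y + (root x != root y).
  have := tri x (root x) y; have := tri (root x) (root y) y.
  rewrite (dC (root y)) -/(h x) -/(h y) /root.
  by case: ifP => _; case: ifP => _; rewrite ?eqxx ?(dxx dT) ?cv ?vc ?cNv ?vNc; nlia.
have x0root : root x0 = c by rewrite /root inE SU // eqxx.
have wroot : root w = v.
  by rewrite /root ifN // (notin_side dT _ cv).
have x0h : h x0 = r by rewrite /h x0root.
have wh : h w = r by rewrite /h wroot dC.
have indB : {in B &, forall b b', b != b' -> far d r b b'}.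
  move=> x y; rewrite !inE => /eqP xh /eqP yh xy.
  have [eqr|/cross] := eqVneq (root x) (root y); last by rewrite /far xh yh; nlia.
  have [[xr xv]|[xr xv]] := rootP x; have [[yr yv]|[yr yv]] := rootP y.
  - apply: (branch_outside br2) => //; rewrite ?xv ?yv ?xh ?yh //.
      by apply: notS2; rewrite inE xv /h xr.
    by apply: notS2; rewrite inE yv /h yr.
  - by move: cNv; rewrite -xr -yr eqr eqxx.
  - by move: cNv; rewrite -xr -yr eqr eqxx.
  - apply: (branch_outside br) => //; rewrite ?xv ?yv ?xh ?yh //.
      by apply: notS; rewrite inE xv /h xr.
    by apply: notS; rewrite inE yv /h yr.
have mB : B \in mis (far d r) setT.
  apply: misI; rewrite ?subsetT //; first exact/indepP.
  move=> x _ hx; apply/contraT => xB.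
  have xh : h x < r by rewrite ltn_neqAle hr andbT; move: xB; rewrite inE.
  have [b bB [bh bx]] : exists2 b, b \in B & h b = r /\ root x = root b.
    have [[xr _]|[xr _]] := rootP x; [exists x0|exists w];
      by rewrite ?inE ?x0h ?wh ?x0root ?wroot ?eqxx ?xr.
  have bNx : b != x by apply: contraNneq xB => <-.
  by have := hx b bB bNx; have := near x b; rewrite /far bx eqxx bh; nlia.
exists v, B, root; split; rewrite ?cv //.
- move=> b; rewrite inE => /eqP bh.
  by have [[-> ->]|[-> ->]] := rootP b; [left|right]; rewrite bh addn1.
- by move=> b; rewrite inE => /eqP.
- move=> x; have := hr x; have [[xr xv]|[xr xv]] := rootP x; move: xv; rewrite /h xr; nlia.
- apply: card_mis_ge_compl => // x y xB yB _ fxy; have := near x y.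
  have : h x < r by rewrite ltn_neqAle hr andbT; move: xB; rewrite inE.
  have : h y < r by rewrite ltn_neqAle hr andbT; move: yB; rewrite inE.
  by move: fxy; rewrite /far; case: eqP => _; nlia.
- split; rewrite ?inE ?x0h ?wh // cross ?x0root ?wroot // x0h wh; nlia.
Qed.

(** A vertex outside the deep branch is within distance [r.+1] of [c]; whether this
    distance is attained decides between two hubs and one. *)
Lemma hub_structure_exists : exists u v B root b1 b2, hub_structure d r u v B root b1 b2.
Proof.
have V0 : [set: V] != set0 by rewrite -card_gt0 cardsT; nlia.
have [x0 [x' [_ _ dmax]]] := diametral_pair d V0.
case: (ltnP (d x0 x') (r + r)) => dr.
  have le : #|V| <= #|mis (far d r) setT|.
    rewrite -[#|V|]cardsT; apply: card_mis_close => x y xT yT.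
    by rewrite /far -ltnNge; have := dmax x y xT yT; nlia.
  have q2 : 2 <= #|V|.-1 %/ r by rewrite leq_divRL; nlia.
  have := leq_trans le V_min; rewrite /min_mis; have -> : r < #|V| by nlia.
  move: (leq_div #|V|.-1 r); nlia.
have [a [c [br _ x0c x'S]]] :=
  diametral_branch dT r2 (@convexT _ d) (in_setT x0) (in_setT x') dmax dr.
case: (boolP [forall x, d x c <= r]) => [/forallP ecc|].
  have [B hB] := hub_structure_one br x'S dr ecc.
  by exists c, c, B, (fun=> c), x0, x'.
case/forallPn => w; rewrite -ltnNge => wr.
have wS : w \notin side d a c.
  have [_ _ _ _ hS] := br; apply/negP => wS.
  have := hS w; rewrite setTI => /(_ wS).
  by move: wS; rewrite inE => /eqP; nlia.
have [|v [B [root hB]]] := hub_structure_two br wS.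
  by have := branch_depth br wS; nlia.
by exists c, v, B, root, x0, w.
Qed.

End Minimal.

(** * Branches, legs and the base of a minimal tree *)

Lemma card_bigcup_disjoint (I T : finType) (A : {set I}) (F : I -> {set T}) :
    {in A &, forall i j x, x \in F i -> x \in F j -> i = j} ->
  #|\bigcup_(i in A) F i| = \sum_(i in A) #|F i|.
Proof.
move=> disj; rewrite -sum1_card big_mkcond /=.
under [RHS]eq_bigr => i _ do rewrite -sum1_card big_mkcond /=.
rewrite exchange_big /=; apply: eq_bigr => x _.
case: ifP => [/bigcupP[i iA xi]|/negP h].
  rewrite (bigD1 i) //= xi big1 ?addn0 // => j /andP[jA ji].
  by case: ifP => // xj; rewrite (disj i j iA jA x xi xj) eqxx in ji.
rewrite big1 // => i iA; case: ifP => // xi.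
by case: h; apply/bigcupP; exists i.
Qed.

Lemma subset_of_card (T : finType) (S : {set T}) n : n <= #|S| ->
  exists2 A : {set T}, A \subset S & #|A| = n.
Proof.
move=> nS; exists [set x in take n (enum S)].
  by apply/subsetP => x; rewrite inE => /mem_take; rewrite mem_enum.
rewrite cardsE; have /card_uniqP -> : uniq (take n (enum S)).
  by rewrite take_uniq // enum_uniq.
by rewrite size_takel // -cardE.
Qed.

(** Outside [X] there are only legs: for [b] in [A], the path [leg b 0], [leg b 1],
    up to [leg b r.-1] hangs at [root b], and its vertices have no other
    neighbours than those on the path and [root b]. *)
Record leg_family (V : finType) (d : V -> V -> nat) (r : nat)
    (X A : {set V}) (root : V -> V) (leg : V -> nat -> V) : Prop := {
  leg_card : #|X| + r * #|A| = #|V|;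
  leg_cover : forall x, x \notin X ->
    exists b t, [/\ b \in A, t < r & x = leg b t];
  leg_out : forall b t, b \in A -> t < r -> leg b t \notin X;
  leg_inj : forall b b' t t', b \in A -> b' \in A -> t < r -> t' < r ->
    leg b t = leg b' t' -> b = b' /\ t = t';
  leg_first : forall b, b \in A -> d (root b) (leg b 0) = 1;
  leg_next : forall b t, b \in A -> t.+1 < r -> d (leg b t) (leg b t.+1) = 1;
  leg_nbr : forall b t z, b \in A -> t < r -> d z (leg b t) = 1 ->
    z = (if t is t'.+1 then leg b t' else root b) \/
    (t.+1 < r /\ z = leg b t.+1) }.

(** For a tree of diameter [r + r] or [(r + r).+1] this is its usual centre; the
    restriction to [X] serves to compare a tree with its base. *)
Definition centre (V : finType) (d : V -> V -> nat) (r : nat) (X : {set V}) :=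
  let C i := [set x in X | [forall y in X, d x y <= i]] in
  if C r != set0 then C r else C r.+1.

Section Branches.

Variables (V : finType) (d : V -> V -> nat) (r : nat).
Hypotheses (dT : tree_metric d) (r2 : 2 <= r).

Implicit Types (a c x y z : V).

Let dC x y : d x y = d y x. Proof. exact: tm_sym dT x y. Qed.
Let tri x y z : d x z <= d x y + d y z. Proof. exact: tm_tri dT x y z. Qed.

Variables (u v : V) (B : {set V}) (root : V -> V) (b1 b2 : V).
Hypothesis hub : hub_structure d r u v B root b1 b2.

Definition anchor b := odflt b [pick a | (d (root b) a == 1) && (d a b == r.-1)].

Definition branch b := side d (anchor b) (root b).

Lemma anchorP b : b \in B -> d (root b) (anchor b) = 1 /\ d (anchor b) b = r.-1.
Proof.
move=> bB; have br := hub_depth hub bB.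
rewrite /anchor; case: pickP => [a /andP[/eqP ? /eqP ?] //|h].
have [|a [a1 a2 _]] := @geodesic _ _ dT (root b) b 1; first by rewrite dC br; nlia.
by have := h a; rewrite a1 a2 dC br subn1 !eqxx.
Qed.

Let anchor1 b : b \in B -> d (anchor b) (root b) = 1.
Proof. by move=> /anchorP[]; rewrite dC. Qed.

Lemma anchor_branch b : b \in B -> anchor b \in branch b.
Proof. by move=> bB; apply: side_l => //; apply: anchor1. Qed.

Lemma mem_branch b : b \in B -> b \in branch b.
Proof.
move=> bB; rewrite inE (hub_depth hub bB).
by have [_] := anchorP bB; rewrite dC => ->; apply/eqP; nlia.
Qed.

Lemma branch_geq b : b \in B -> r <= #|branch b|.
Proof.
move=> bB; have := @card_geodesic _ _ dT (branch b) (anchor b) b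
  (side_convex dT (anchor1 bB)) (anchor_branch bB) (mem_branch bB).
by have [_ ->] := anchorP bB; nlia.
Qed.

Let hubs_notin b x : b \in B -> x \in [set u; v] -> x \notin branch b.
Proof.
move=> bB xh; have [e1 e2] := anchorP bB; have br := hub_depth hub bB.
have uv := hub_close hub.
have [->|xr] := eqVneq x (root b); first by rewrite inE (dxx dT).
have dx : d b x = r + d u v.
  have [[E ?]|[E ?]] := hub_root hub bB; case/set2P: xh xr => -> //;
  by rewrite E eqxx.
have dxr : d x (root b) <= 1.
  have [[E ?]|[E ?]] := hub_root hub bB; rewrite E; case/set2P: xh => ->;
  by rewrite ?(dxx dT) // dC.
rewrite inE; apply/eqP => h; have : d x (anchor b) = 0 by nlia.
move/(d0_eq dT) => xa; move: dx; rewrite xa dC e2; nlia.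
Qed.

(** For equal roots the branches are those of distinct neighbours of the root,
    since vertices of one branch are not far.  For distinct roots, each branch
    lies on the side of its own root. *)
Lemma branch_disjoint :
  {in B &, forall b b' x, x \in branch b -> x \in branch b' -> b = b'}.
Proof.
move=> b b' bB b'B x xb xb'; apply/eqP/contraT => bb'.
have [e1 e2] := anchorP bB; have [e1' e2'] := anchorP b'B.
have ffar := hub_far hub bB b'B bb'.
have a1 := anchor1 bB; have a1' := anchor1 b'B.
have [eqr|nr] := eqVneq (root b) (root b').
  have aa' : anchor b != anchor b'.
    apply: contraTneq ffar => E; rewrite /far -ltnNge.
    by have := tri b (anchor b) b'; rewrite (dC b (anchor b)) e2 E e2'; nlia.
  have a's : anchor b' \in side d (root b) (anchor b).
    rewrite -(notin_side dT _ a1) inE eqr a1'; apply/eqP => -[/esym/(d0_eq dT) E].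
    by rewrite E eqxx in aa'.
  have := side_bridge dT a1 xb a's; move: xb xb'; rewrite !inE eqr e1'.
  by move=> /eqP h1 /eqP h2 h3; nlia.
have uv : d u v = 1.
  have := hub_close hub; case E : (d u v) => [|[|//]] // _.
  move/(d0_eq dT): E nr => E.
  by have [[-> _]|[-> _]] := hub_root hub bB; have [[-> _]|[-> _]] := hub_root hub b'B;
    rewrite ?E eqxx.
have rr' : d (root b) (root b') = 1.
  by have [[E _]|[E _]] := hub_root hub bB; have [[E' _]|[E' _]] := hub_root hub b'B;
    move: nr; rewrite E E' ?eqxx // dC.
have step c c' : c \in B -> c' \in B -> d (root c) (root c') = 1 ->
    x \in branch c -> d x (root c') = (d x (root c)).+1.
  move=> cB c'B cc' xc; have c's : root c' \in side d (root c) (anchor c).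
    rewrite -(notin_side dT _ (anchor1 cB)); apply: hubs_notin => //.
    by have [[-> _]|[-> _]] := hub_root hub c'B; rewrite !inE eqxx ?orbT.
  rewrite (side_bridge dT (anchor1 cB) xc c's) cc'.
  by move: xc; rewrite inE => /eqP ->; nlia.
have := step b b' bB b'B rr' xb; have := step b' b b'B bB _ xb'.
by rewrite dC => /(_ rr'); nlia.
Qed.

Lemma branch_sum : \sum_(b in B) #|branch b| < #|V|.
Proof.
rewrite -(card_bigcup_disjoint branch_disjoint) -cardsT; apply: proper_card.
apply/properP; split; first exact: subsetT.
exists u => //; apply/bigcupP => -[b bB]; apply/negP; apply: hubs_notin => //.
exact: set21.
Qed.

Definition bare : {set V} := [set b in B | #|branch b| == r].

(** Disjoint branches with at least [r] vertices each, and at least [r.+1] if they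
    are not bare; [u] is in none of them. *)
Lemma bare_geq : r * #|B| + #|B| < #|V| + #|bare|.
Proof.
suff : r * #|B| + #|B| <= \sum_(b in B) #|branch b| + #|bare|.
  by have := branch_sum; nlia.
have -> : #|bare| = \sum_(b in B) (#|branch b| == r).
  by rewrite -sum1_card big_mkcond [RHS]big_mkcond /=; apply: eq_bigr => b _;
    rewrite inE; case: (b \in B) => //=; case: eqP.
rewrite -big_split /= mulnC -mulnSr -sum_nat_const; apply: leq_sum => b bB.
by have := branch_geq bB; case: eqP; nlia.
Qed.

Definition leg b t := odflt b [pick z in branch b | d z (anchor b) == t].

Lemma legP b t : b \in B -> t < r -> leg b t \in branch b /\ d (leg b t) (anchor b) = t.
Proof.
move=> bB tr; rewrite /leg; case: pickP => [z /andP[? /eqP]//|h].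
have [e1 e2] := anchorP bB.
have [|z [z1 z2 z3]] := @geodesic _ _ dT (anchor b) b t; first by rewrite e2; nlia.
have zb : z \in branch b.
  exact: (side_convex dT (anchor1 bB) (anchor_branch bB) (mem_branch bB)).
by have := h z; rewrite /= zb dC z1 eqxx.
Qed.

Lemma bareB b : b \in bare -> b \in B.
Proof. by rewrite inE => /andP[]. Qed.

(** A bare branch contains [r] vertices, at depths 0 to [r.-1]; hence one of each. *)
Lemma bare_leg b z : b \in bare -> z \in branch b ->
  d z (anchor b) < r /\ z = leg b (d z (anchor b)).
Proof.
move=> bb; have bB := bareB bb; move: bb; rewrite inE => /andP[_ /eqP br].
have inj : injective (fun t : 'I_r => leg b t).
  move=> t t' E; apply: val_inj => /=.
  by rewrite -(legP bB (ltn_ord t)).2 -(legP bB (ltn_ord t')).2 E.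
have : [set leg b t | t : 'I_r] = branch b.
  apply/eqP; rewrite eqEcard card_imset // card_ord br leqnn andbT.
  by apply/subsetP => _ /imsetP[t _ ->]; case: (legP bB (ltn_ord t)).
move=> <- /imsetP[t _ ->]; have [_ e] := legP bB (ltn_ord t).
by rewrite e.
Qed.

Section Base.

Variable A : {set V}.
Hypothesis Abare : A \subset bare :\: [set b1; b2].

Let AB b : b \in A -> b \in B.
Proof. by move=> /(subsetP Abare); rewrite inE => /andP[_ /bareB]. Qed.

Let Ab b : b \in A -> b \in bare.
Proof. by move=> /(subsetP Abare); rewrite inE => /andP[]. Qed.

Definition base : {set V} := ~: \bigcup_(b in A) branch b.

Lemma base_convex : convex d base.
Proof.
move=> x y z; rewrite !inE => xX yX e; apply/bigcupP => -[b bA zb].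
have out w : w \notin \bigcup_(b in A) branch b ->
    w \in side d (root b) (anchor b).
  rewrite -(notin_side dT _ (anchor1 (AB bA))); apply: contra => wb.
  by apply/bigcupP; exists b.
have := side_convex dT (proj1 (anchorP (AB bA))) (out x xX) (out y yX) e.
by rewrite -(notin_side dT _ (anchor1 (AB bA))) zb.
Qed.

Lemma hub_base x : x \in [set u; v] -> x \in base.
Proof.
move=> xh; rewrite inE; apply/bigcupP => -[b bA]; apply/negP.
exact: hubs_notin (AB bA) xh.
Qed.

Lemma end_base b : b \in B -> b \notin A -> b \in base.
Proof.
move=> bB bA; rewrite inE; apply/bigcupP => -[b' b'A bb'].
by rewrite (branch_disjoint bB (AB b'A) (mem_branch bB) bb') b'A in bA.
Qed.

Lemma base_leg_family : leg_family d r base A root leg.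
Proof.
split.
- rewrite /base -(cardsC (\bigcup_(b in A) branch b)) addnC; congr (_ + _).
  rewrite card_bigcup_disjoint; last first.
    by move=> b b' /AB bB /AB b'B; apply: branch_disjoint.
  rewrite mulnC -sum_nat_const; apply: eq_bigr => b /Ab.
  by rewrite inE => /andP[_ /eqP->].
- move=> x; rewrite inE negbK => /bigcupP[b bA xb].
  by have [h1 h2] := bare_leg (Ab bA) xb; exists b, (d x (anchor b)).
- move=> b t bA tr; rewrite inE negbK; apply/bigcupP; exists b => //.
  by case: (legP (AB bA) tr).
- move=> b b' t t' bA b'A tr tr' E.
  have [h1 h2] := legP (AB bA) tr; have [h1' h2'] := legP (AB b'A) tr'.
  rewrite E in h1; have bb' := branch_disjoint (AB bA) (AB b'A) h1 h1'.
  by split=> //; rewrite -h2 -h2' E bb'.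
- move=> b bA; have [_ /(d0_eq dT) ->] := @legP b 0 (AB bA) (ltnW r2).
  by case: (anchorP (AB bA)).
- move=> b t bA tr; have [h1 h2] := legP (AB bA) tr.
  have [|z [z1 z2 z3]] := @geodesic _ _ dT (leg b t.+1) (anchor b) 1.
    by rewrite h2.
  have zb : z \in branch b.
    exact: (side_convex dT (anchor1 (AB bA)) h1 (anchor_branch (AB bA))).
  have [_ zE] := bare_leg (Ab bA) zb.
  by move: z1; rewrite {1}zE z2 h2 subn1 dC.
- move=> b t z bA tr z1; have [h1 h2] := legP (AB bA) tr.
  case: (boolP (z \in branch b)) => zb.
    have [h3 h4] := bare_leg (Ab bA) zb.
    have [zt|zt] : t = (d z (anchor b)).+1 \/ d z (anchor b) = t.+1.
      have := tm_step dT (anchor b) z1.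
      by rewrite (dC (anchor b)) [d _ z]dC h2; nlia.
    + by left; rewrite zt.
    by right; rewrite -zt.
  have zr : z \in side d (root b) (anchor b).
    by rewrite -(notin_side dT _ (anchor1 (AB bA))).
  move: (side_bridge dT (anchor1 (AB bA)) h1 zr); rewrite dC z1 h2 => E.
  have t0 : t = 0 by nlia.
  by left; rewrite t0; apply/esym/(d0_eq dT); nlia.
Qed.

(** The vertices [b1] and [b2] remain in the base, and they force a vertex of small
    eccentricity to be a hub.  With two hubs no vertex is within distance [r]
    of both [b1] and [b2]. *)
Lemma base_centre : centre d r base = [set u; v].
Proof.
have [b1B b2B r1 r2' d12] := hub_ends hub.
have b1X : b1 \in base.
  by apply: end_base => //; apply/negP => /(subsetP Abare); rewrite !inE eqxx.
have b2X : b2 \in base.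
  by apply: end_base => //; apply/negP => /(subsetP Abare); rewrite !inE eqxx orbT.
have d1 : d b1 u = r by rewrite -r1 (hub_depth hub).
have d2 : d b2 v = r by rewrite -r2' (hub_depth hub).
pose C i := [set x in base | [forall y in base, d x y <= i]].
have CE : C (r + d u v) = [set u; v].
  apply/setP => x; apply/idP/idP => [|xh]; last first.
    rewrite inE hub_base //; apply/forall_inP => y _; rewrite dC.
    by have [? ?] := hub_ecc hub y; case/set2P: xh => ->.
  rewrite inE => /andP[_ /forall_inP xC].
  have := xC b1 b1X; have := xC b2 b2X.
  have := hub_close hub; case E : (d u v) => [|[|//]] // _.
    have uv := d0_eq dT E; rewrite -uv in d2 r2' *; rewrite addn0 => x2 x1.
    have a1 := anchor1 b1B.
    case: (boolP (x \in branch b1)) => xb; last first.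
      have xs : x \in side d (root b1) (anchor b1) by rewrite -(notin_side dT _ a1).
      have := side_bridge dT (anchorP b1B).1 xs (mem_branch b1B).
      rewrite (anchorP b1B).2 r1 => ex.
      have /(d0_eq dT) -> : d x u = 0 by nlia.
      exact: set21.
    have b2s : b2 \in side d (root b1) (anchor b1).
      rewrite -(notin_side dT _ a1); apply/negP => b2b.
      have := branch_disjoint b1B b2B b2b (mem_branch b2B) => E12.
      by move: d12; rewrite E12 (dxx dT); nlia.
    have := side_bridge dT a1 xb b2s; rewrite r1 (dC u) d2; nlia.
  have b1s : b1 \in side d u v.
    rewrite inE d1; have := hub_root hub b1B; rewrite E r1.
    by case=> -[h1 h2]; [rewrite h2 addn1|move: E; rewrite h1 (dxx dT)].
  have vu : d v u = 1 by rewrite dC.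
  have b2s : b2 \in side d v u.
    rewrite inE d2; have := hub_root hub b2B; rewrite E r2'.
    by case=> -[h1 h2]; [move: E; rewrite h1 (dxx dT)|rewrite h2 addn1].
  case: (boolP (x \in side d u v)) => xs x2 x1.
    have := side_bridge dT E xs b2s; rewrite (dC v) d2 => ex.
    have /(d0_eq dT) -> : d x u = 0 by nlia.
    exact: set21.
  rewrite (notin_side dT _ E) in xs.
  have := side_bridge dT vu xs b1s; rewrite (dC u) d1 => ex.
  have /(d0_eq dT) -> : d x v = 0 by nlia.
  exact: set22.
rewrite /centre -!/(C _).
have := hub_close hub; case E : (d u v) CE => [|[|//]] CE _.
  by rewrite addn0 in CE; rewrite CE; case: eqP => // /setP/(_ u); rewrite !inE eqxx.
have -> : C r = set0.
  apply/setP => x; rewrite !inE; apply/andP => -[_ /forall_inP h].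
  have := h b1 b1X; have := h b2 b2X; have := tri b1 x b2.
  by rewrite (dC b1 x) d12 E; nlia.
by rewrite eqxx /= -CE addn1.
Qed.

End Base.

End Branches.

(** Minimality gives [m <= #|B|], and the size of the tree then gives [#|B| = m] and
    at most [s] branches that are not bare.  Sparing [b1] and [b2], there remain
    [m - s - 2] legs to remove. *)
Theorem minimal_decomposition (V : finType) (d : V -> V -> nat) (r m s : nat) :
    tree_metric d -> 2 <= r -> #|V| = (m * r + s).+1 -> s < r -> 2 <= m ->
    0 < s -> #|mis (far d r) setT| <= min_mis r #|V| ->
  exists X A root leg u v,
    [/\ convex d X, leg_family d r X A root leg, #|A| = m - s - 2,
        {in A, forall b, root b \in [set u; v]}
      & centre d r X = [set u; v]].
Proof.
move=> dT r2 Vn sr m2 s0 Vmin.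
have mr : 2 * r <= m * r by rewrite leq_mul2r m2 orbT.
have Vr : r.*2 < #|V| by rewrite Vn; nlia.
have [u [v [B [root [b1 [b2 hub]]]]]] := hub_structure_exists dT r2 Vr Vmin.
have q : #|V|.-1 %/ r = m by rewrite Vn /= divnMDl ?divn_small ?addn0 //; nlia.
have Bm : m <= #|B|.
  have := hub_card hub; move: Vmin; rewrite /min_mis q.
  have -> : r < #|V| by nlia.
  by have : m <= #|V|; [rewrite -q; apply: leq_trans (leq_div _ _) (leq_pred _)|nlia].
have bareE := bare_geq dT r2 hub.
have Bm' : #|B| = m.
  apply/eqP; rewrite eqn_leq Bm andbT leqNgt; apply/negP => mB.
  have : m.+1 * r <= #|B| * r by rewrite leq_mul2r mB orbT.
  have : #|bare d r B root| <= #|B|.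
    by apply: subset_leq_card; apply/subsetP => b; rewrite inE => /andP[].
  by rewrite mulSn [_ * r]mulnC; move: bareE; rewrite Vn; nlia.
have card2 : #|[set b1; b2]| <= 2 by rewrite cards2; case: eqP.
have [|A AS Ac] := @subset_of_card _ (bare d r B root :\: [set b1; b2]) (m - s - 2).
  have := cardsD (bare d r B root) [set b1; b2].
  have := subset_leq_card (subsetIr (bare d r B root) [set b1; b2]).
  move: bareE; rewrite Vn Bm' [r * m]mulnC; nlia.
exists (base d r root A), A, root, (leg d r root), u, v; split=> //.
- exact: (base_convex dT r2 hub AS).
- exact: (base_leg_family dT r2 hub AS).
- move=> b /(subsetP AS); rewrite inE => /andP[_ /bareB bB].
  by have [[-> _]|[-> _]] := hub_root hub bB; rewrite !inE eqxx ?orbT.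
exact: (base_centre dT r2 hub AS).
Qed.

(** * Isomorphism classes of graphs *)

Section Isomorphism.

Variable T : finType.
Implicit Types (E F : {set {set T}}) (x y : T) (e : rel T).

Definition edges_of e : {set {set T}} := [set [set z.1; z.2] | z : T * T & e z.1 z.2].

Lemma adj_edges_of e : symmetric e -> adj (edges_of e) =2 e.
Proof.
move=> eC x y; apply/imsetP/idP => [[[a b] /=]|exy]; last by exists (x, y); rewrite ?inE.
rewrite inE /= => eab eqS.
have xS : x \in [set a; b] by rewrite -eqS set21.
have yS : y \in [set a; b] by rewrite -eqS set22.
have aS : a \in [set x; y] by rewrite eqS set21.
have bS : b \in [set x; y] by rewrite eqS set22.
case/set2P: xS => xE; case/set2P: yS => yE; rewrite xE yE // in aS bS *.
- by move: bS; rewrite !inE orbb => /eqP bE; rewrite bE in eab.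
- by rewrite eC.
- by move: aS; rewrite !inE orbb => /eqP aE; rewrite aE in eab.
Qed.

Lemma simple_edges_of e : irreflexive e -> simple_graph (edges_of e).
Proof.
move=> eI; apply/forall_inP => _ /imsetP[[a b] + ->]; rewrite inE /= cards2 => eab.
by case: (eqVneq a b) eab => // ->; rewrite eI.
Qed.

Lemma eq_simple_graph E F :
  simple_graph E -> simple_graph F -> adj E =2 adj F -> E = F.
Proof.
move=> /forall_inP sE /forall_inP sF eqEF; apply/setP => S.
apply/idP/idP => [SE|SF].
  have /cards2P[x [y [_ SS]]] := sE S SE; subst S.
  by have : adj E x y := SE; rewrite eqEF.
have /cards2P[x [y [_ SS]]] := sF S SF; subst S.
by have : adj F x y := SF; rewrite -eqEF.
Qed.

Lemma adj_irr E : simple_graph E -> irreflexive (adj E).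
Proof. by move=> sE x; apply/negP => /(adj_neq sE); rewrite eqxx. Qed.

Lemma adj_imset E (s : {perm T}) x y :
  adj [set s @: (S : {set T}) | S in E] (s x) (s y) = adj E x y.
Proof.
have -> : adj [set s @: (S : {set T}) | S in E] (s x) (s y) =
    (s @: [set x; y] \in [set s @: (S : {set T}) | S in E]).
  by rewrite imsetU1 imset_set1.
by rewrite mem_imset //; apply: imset_inj; apply: perm_inj.
Qed.

Lemma graph_isoP E F : simple_graph E -> simple_graph F ->
  reflect (exists s : {perm T}, forall x y, adj F (s x) (s y) = adj E x y)
          (graph_iso E F).
Proof.
move=> sE sF; apply: (iffP existsP) => -[s h]; exists s.
  by move=> x y; rewrite (eqP h) adj_imset.
apply/eqP; apply: eq_simple_graph => //.
  apply/forall_inP => _ /imsetP[S SE ->]; rewrite card_imset; last exact: perm_inj.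
  by move/forall_inP: sE; apply.
by move=> x y; rewrite -[x](permKV s) -[y](permKV s) h adj_imset.
Qed.

Lemma graph_isoI E F (f : T -> T) : simple_graph E -> simple_graph F ->
  injective f -> (forall x y, adj F (f x) (f y) = adj E x y) -> graph_iso E F.
Proof.
move=> sE sF fI h; apply/graph_isoP => //; exists (perm fI) => x y.
by rewrite !permE.
Qed.

Lemma graph_iso_refl E : simple_graph E -> graph_iso E E.
Proof. by move=> sE; apply: (@graph_isoI _ _ id). Qed.

Lemma graph_iso_sym E F :
  simple_graph E -> simple_graph F -> graph_iso E F -> graph_iso F E.
Proof.
move=> sE sF /graph_isoP-/(_ sE sF)[s h]; apply/graph_isoP => //.
by exists (s^-1)%g => x y; rewrite -h !permKV.
Qed.

Lemma graph_iso_trans E F G :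
    simple_graph E -> simple_graph F -> simple_graph G ->
  graph_iso E F -> graph_iso F G -> graph_iso E G.
Proof.
move=> sE sF sG /graph_isoP-/(_ sE sF)[s hs] /graph_isoP-/(_ sF sG)[t ht].
by apply/graph_isoP => //; exists (s * t)%g => x y; rewrite !permM ht hs.
Qed.

Section Classes.

Variable A : {set {set {set T}}}.
Hypothesis sA : {in A, forall E, simple_graph E}.

(** Bounding a number of classes from above by a list of graphs that meets every
    class; the listed graphs themselves need not belong to [A]. *)
Lemma num_iso_classes_le (I : finType) (C : {set I}) (g : I -> {set {set T}}) :
    (forall c, simple_graph (g c)) ->
    {in A, forall E, exists2 c, c \in C & graph_iso (g c) E} ->
  num_iso_classes A <= #|C|.
Proof.
move=> sg cov.
apply: leq_trans (leq_imset_card (fun c => [set F in A | graph_iso (g c) F]) C).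
apply: subset_leq_card; apply/subsetP => _ /imsetP[E EA ->].
have [c cC iso] := cov E EA; apply/imsetP; exists c => //.
apply/setP => F; rewrite !inE; case FA: (F \in A) => //=.
apply/idP/idP; first exact: graph_iso_trans (sg c) (sA EA) (sA FA) iso.
apply: graph_iso_trans (sA EA) (sg c) (sA FA) _.
exact: graph_iso_sym (sg c) (sA EA) iso.
Qed.

Lemma num_iso_classes_ge (I : finType) (g : I -> {set {set T}}) :
    (forall i, g i \in A) -> (forall i j, graph_iso (g i) (g j) -> i = j) ->
  #|I| <= num_iso_classes A.
Proof.
move=> gA gI; pose f i := [set F in A | graph_iso (g i) F].
have fI : injective f.
  move=> i j /setP/(_ (g j)); rewrite !inE gA /= graph_iso_refl ?sA //.
  by move/gI.
rewrite -cardsT -(card_imset _ fI); apply: subset_leq_card.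
apply/subsetP => _ /imsetP[i _ ->]; apply/imsetP; exists (g i); first exact: gA.
  apply/setP => F; rewrite !inE. by [].
Qed.

Lemma iso_representatives : exists R : {set {set {set T}}},
  [/\ R \subset A, #|R| <= num_iso_classes A
    & {in A, forall E, exists2 F, F \in R & graph_iso F E}].
Proof.
pose rep (b : {set {set {set T}}}) := odflt set0 [pick E in b].
have repP E : E \in A -> rep [set F in A | graph_iso E F] \in A /\
    graph_iso E (rep [set F in A | graph_iso E F]).
  move=> EA; rewrite /rep; case: pickP => [F|/(_ E)].
    by rewrite inE => /andP[].
  by rewrite inE EA graph_iso_refl ?sA.
exists (rep @: equivalence_partition (@graph_iso T) A); split.
- by apply/subsetP => _ /imsetP[_ /imsetP[E EA ->] ->]; case: (repP E EA).
- exact: leq_imset_card.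
- move=> E EA; have [h1 h2] := repP E EA.
  exists (rep [set F in A | graph_iso E F]); first by rewrite !imset_f.
  by apply: graph_iso_sym; rewrite ?sA.
Qed.

End Classes.

End Isomorphism.

(** On a cycle, a vertex of maximal rank has two distinct neighbours, neither of
    larger rank. *)
Lemma acyclic_rank (T : finType) (E : {set {set T}}) (rk : T -> nat) :
    (forall x y z, adj E x y -> adj E x z -> rk y <= rk x -> rk z <= rk x -> y = z) ->
  acyclic E.
Proof.
move=> h; apply/existsP => -[d /andP[d2 /existsP[c /andP[cyc uc]]]].
have sc : size c = d by rewrite size_tuple.
have [x0 x0c] : exists x, x \in (c : seq T).
  by case: (tval c) sc d2 => [<-//|x s _ _]; exists x; rewrite mem_head.
case: (arg_maxnP rk x0c) => x xc xmax.
have [i s Es] := rot_to xc.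
have us : uniq (x :: s) by rewrite -Es rot_uniq.
have cs : path.cycle (adj E) (x :: s) by rewrite -Es rot_cycle.
have ms z : z \in s -> z \in (c : seq T).
  by move=> zs; rewrite -(mem_rot i) Es inE zs orbT.
have ss : 1 < size s by rewrite -ltnS -[(size s).+1]/(size (x :: s)) -Es size_rot sc.
case: s us cs ms ss {Es} => [//|y s]; case/lastP: s => [//|s z] us cs ms _.
have xy : adj E x y by move: cs => /andP[].
have xz : adj E x z.
  by move: cs; rewrite adjC /= rcons_path last_rcons => /and3P[].
have ys : y \in y :: rcons s z by rewrite mem_head.
have zs : z \in y :: rcons s z by rewrite inE mem_rcons mem_head orbT.
have yz := h _ _ _ xy xz (xmax _ (ms y ys)) (xmax _ (ms z zs)).
by move: us => /= /and3P[_ + _]; rewrite yz mem_rcons mem_head.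
Qed.

(** * Reattaching the legs to the base *)

(** The subtree on a convex set of vertices, moved to another vertex type by a
    bijection [g]. *)
Section Pullback.

Variables (T T' : finType) (E : {set {set T}}) (E' : {set {set T'}}) (g : T' -> T).
Hypotheses (tE : is_tree E) (sE' : simple_graph E') (gI : injective g).
Hypothesis adjg : forall i j, adj E (g i) (g j) = adj E' i j.
Hypothesis cX : convex (dist E) [set g i | i : T'].

Let dT := tree_metric_dist tE.

Let step i j l : dist E (g i) (g j) = l.+1 ->
  exists2 i', adj E' i i' & dist E (g i') (g j) = l.
Proof.
move=> e; have [|z [z1 z2 z3]] := @geodesic _ _ dT (g i) (g j) 1; first by rewrite e.
have /imsetP[i' _ zE] : z \in [set g i | i : T'] by apply: cX z3; apply: imset_f.
exists i'; last by rewrite -zE z2 e subn1.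
by rewrite -adjg -zE -(dist1E tE) z1.
Qed.

Let walk i j : exists p, [/\ path (adj E') i p, last i p = j
  & size p = dist E (g i) (g j)].
Proof.
have [l e] : exists l, dist E (g i) (g j) = l by eexists.
elim: l i e => [|l IHl] i e.
  by exists [::]; rewrite e; split=> //; apply: gI; apply: (d0_eq dT).
have [i' ii' e'] := step e; have [p [pp pl sp]] := IHl i' e'.
by exists (i' :: p); rewrite /= ii' pp pl sp e' e.
Qed.

Lemma pullback_tree : 0 < #|T'| -> is_tree E'.
Proof.
move=> T0; apply/and3P; split=> //.
  rewrite /connected T0; apply/forallP => i; apply/forallP => j.
  by have [p [pp pl _]] := walk i j; apply/connectP; exists p.
case/and3P: tE => _ _; apply: contra => /existsP[d /andP[d2 /existsP[c uc]]].
have dT' : d < #|T|.+1 by rewrite (leq_trans (ltn_ord d)) // ltnS (leq_card g gI).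
apply/existsP; exists (Ordinal dT'); rewrite d2 /=; apply/existsP.
exists (map_tuple g c); case/andP: uc => cyc uc.
rewrite /ucycleb /= (map_inj_uniq gI) uc andbT.
by rewrite (mono_cycle (e := adj E')) // => i j; rewrite adjg.
Qed.

Hypothesis T0 : 0 < #|T'|.

Lemma pullback_dist i j : dist E' i j = dist E (g i) (g j).
Proof.
apply/eqP; rewrite eqn_leq; apply/andP; split.
  by have [p [pp <- <-]] := walk i j; apply: dist_le.
have [p [<- pp <-]] := dist_path (tree_connect (pullback_tree T0) i j).
rewrite -last_map -(size_map g); apply: dist_le.
by rewrite path_map (eq_path (e' := adj E')).
Qed.

Lemma pullback_centre r :
  centre (dist E) r [set g i | i : T'] = g @: centre (dist E') r setT.
Proof.
have CE n : [set x in [set g i | i : T'] | [forall y in [set g i | i : T'], dist E x y <= n]]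
    = g @: [set x in setT | [forall y in setT, dist E' x y <= n]].
  apply/setP => x; apply/idP/imsetP => [|[i + ->]]; rewrite !inE => /andP.
    case=> /imsetP[i _ ->] /forall_inP h; exists i => //; rewrite !inE /=.
    by apply/forall_inP => j _; rewrite pullback_dist; apply: h; apply: imset_f.
  case=> _ /forall_inP h; rewrite imset_f //=; apply/forall_inP => _ /imsetP[j _ ->].
  by rewrite -pullback_dist; apply: h; rewrite inE.
by rewrite /centre !CE imset_eq0; case: ifP.
Qed.

End Pullback.

(** Vertices below [b] are those of the base; the leg number [l] occupies
    [b + r * l] to [b + r * l + r.-1] and hangs at [x0] if [l < p], and at [y0]
    otherwise.  Natural numbers avoid casts between ordinals. *)
Definition attach_parent (b r p x0 y0 j : nat) : nat :=
  if (j - b) %% r == 0 then (if (j - b) %/ r < p then x0 else y0) else j.-1.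

Lemma leg_index b r L i : 0 < r -> b <= i -> i < b + r * L ->
  exists l t, [/\ i = b + r * l + t, l < L & t < r].
Proof.
move=> r0 bi iN; exists ((i - b) %/ r), ((i - b) %% r).
split; last by rewrite ltn_mod.
  by rewrite -addnA [r * _]mulnC -divn_eq; lia.
by rewrite ltn_divLR // [_ * r]mulnC; lia.
Qed.

Lemma attach_parent_leg b r p x0 y0 l t : t < r ->
  attach_parent b r p x0 y0 (b + r * l + t) =
  if t is t'.+1 then b + r * l + t' else if l < p then x0 else y0.
Proof.
move=> tr; rewrite /attach_parent.
have -> : b + r * l + t - b = l * r + t by lia.
rewrite divnMDl ?modnMDl ?(leq_trans _ tr) // divn_small // modn_small // addn0.
by case: t tr => [|t] _ //; rewrite addnS.
Qed.

Definition attach_below (b r p : nat) (e0 : rel nat) (x0 y0 i j : nat) : bool :=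
  (i < j) && (if j < b then e0 i j else i == attach_parent b r p x0 y0 j).

Definition attach n b r p e0 x0 y0 : {set {set 'I_n}} :=
  edges_of (fun i j : 'I_n => attach_below b r p e0 x0 y0 i j
                           || attach_below b r p e0 x0 y0 j i).

Lemma adj_attach n b r p e0 x0 y0 (i j : 'I_n) :
  adj (attach n b r p e0 x0 y0) i j =
  attach_below b r p e0 x0 y0 i j || attach_below b r p e0 x0 y0 j i.
Proof. by rewrite adj_edges_of // => ? ?; rewrite orbC. Qed.

Lemma simple_attach n b r p e0 x0 y0 : simple_graph (attach n b r p e0 x0 y0).
Proof. by apply: simple_edges_of => i; rewrite /attach_below ltnn. Qed.

Definition nat_adj b (E0 : {set {set 'I_b}}) : rel nat := fun i j =>
  match insub i, insub j with Some x, Some y => adj E0 x y | _, _ => false end.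

(** The legs are enumerated so that those hanging at [g x0] come first; [g] and this
    enumeration then give a bijection from the vertices of the attached graph. *)
Section Gluing.

Variables (n b r : nat) (E : {set {set 'I_n}}) (E0 : {set {set 'I_b}}).
Variables (X A : {set 'I_n}) (root : 'I_n -> 'I_n) (leg : 'I_n -> nat -> 'I_n).
Variables (g : 'I_b -> 'I_n) (x0 y0 : 'I_b).
Hypotheses (tE : is_tree E) (r0 : 0 < r).
Hypothesis legs : leg_family (dist E) r X A root leg.
Hypotheses (gI : injective g) (gX : [set g i | i : 'I_b] = X).
Hypothesis adjg : forall i j, adj E (g i) (g j) = adj E0 i j.
Hypothesis rootE : {in A, forall c, root c \in [set g x0; g y0]}.

Let A1 := [set c in A | root c == g x0].
Let s := enum A1 ++ enum (A :\: A1).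

Let size_s : size s = #|A|.
Proof.
rewrite size_cat -!cardE -(cardsID A1 A); congr (_ + _); apply: eq_card => c.
by rewrite !inE; case: (c \in A).
Qed.

Let uniq_s : uniq s.
Proof.
rewrite cat_uniq !enum_uniq andbT; apply/hasPn => c /=.
by rewrite !mem_enum inE => /andP[].
Qed.

Let mem_s c : (c \in s) = (c \in A).
Proof. by rewrite mem_cat !mem_enum !inE; case: (c \in A); case: eqP. Qed.

Let nE : n = b + r * #|A|.
Proof.
have h := leg_card legs; rewrite card_ord in h.
by apply: etrans (esym h) _; rewrite -gX card_imset // card_ord.
Qed.

Let phi (i : nat) : 'I_n :=
  if insub i is Some i' then g i' else leg (nth (g x0) s ((i - b) %/ r)) ((i - b) %% r).

Let phi_base (i : 'I_b) : phi i = g i.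
Proof. by rewrite /phi valK. Qed.

Let phi_leg l t : t < r -> phi (b + r * l + t) = leg (nth (g x0) s l) t.
Proof.
move=> tr; rewrite /phi insubF; last by apply/negbTE; rewrite -leqNgt; nlia.
have -> : b + r * l + t - b = l * r + t by nlia.
by rewrite divnMDl // modnMDl divn_small // modn_small // addn0.
Qed.

Let leg_ix i : b <= i -> i < n ->
  exists l t, [/\ i = b + r * l + t, l < #|A| & t < r].
Proof. by move=> bi iN; apply: leg_index => //; move: nE; nlia. Qed.

Let nthA l : l < #|A| -> nth (g x0) s l \in A.
Proof. by move=> lA; rewrite -mem_s mem_nth ?size_s. Qed.

Let phi_in i : i < b -> phi i \in X.
Proof. by move=> ib; rewrite (phi_base (Ordinal ib)) -gX imset_f. Qed.

Let phi_out i : b <= i -> i < n -> phi i \notin X.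
Proof.
move=> bi iN; have [l [t [-> lA tr]]] := leg_ix bi iN.
by rewrite phi_leg //; apply: (leg_out legs) => //; apply: nthA.
Qed.

Let phi_inj i j : i < n -> j < n -> phi i = phi j -> i = j.
Proof.
move=> iN jN e; case: (ltnP i b) => ib; case: (ltnP j b) => jb.
- move: e; rewrite (phi_base (Ordinal ib)) (phi_base (Ordinal jb)) => /gI.
  by move/(congr1 val).
- by have := phi_out jb jN; rewrite -e phi_in.
- by have := phi_out ib iN; rewrite e phi_in.
have [l [t [iE lA tr]]] := leg_ix ib iN.
have [l' [t' [jE l'A t'r]]] := leg_ix jb jN.
move: e; rewrite iE jE !phi_leg // => /(leg_inj legs (nthA lA) (nthA l'A) tr t'r)[e ->].
by move/eqP: e; rewrite nth_uniq ?size_s // => /eqP ->.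
Qed.

Let root_nth l : l < #|A| ->
  root (nth (g x0) s l) = if l < #|A1| then g x0 else g y0.
Proof.
move=> lA; rewrite nth_cat -cardE; case: ltnP => lA1.
  have : nth (g x0) (enum A1) l \in A1 by rewrite -mem_enum mem_nth // -cardE.
  by rewrite inE => /andP[_ /eqP].
set c := nth _ _ _; have : c \in A :\: A1.
  rewrite -mem_enum mem_nth //; move: lA; rewrite -size_s size_cat -!cardE.
  by move=> lA; rewrite -(ltn_add2l #|A1|) subnKC.
rewrite !inE => /andP[+ cA]; rewrite cA /= => cx0.
by have /set2P[cE|//] := rootE cA; rewrite cE eqxx in cx0.
Qed.

Let e0 := nat_adj E0.
Let p := #|A1|.

Let par := attach_parent b r p x0 y0.

Let par_leg l t : t < r -> par (b + r * l + t) =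
  if t is t'.+1 then b + r * l + t' else if l < p then x0 : nat else y0 : nat.
Proof. exact: attach_parent_leg. Qed.

Let phi_par l t : l < #|A| -> t < r -> phi (par (b + r * l + t)) =
  if t is t'.+1 then leg (nth (g x0) s l) t' else root (nth (g x0) s l).
Proof.
move=> lA tr; rewrite par_leg //; case: t tr => [|t] tr.
  by rewrite root_nth // -/p; case: ifP => _; rewrite phi_base.
by rewrite phi_leg // ltnW.
Qed.

Let par_lt j : b <= j -> j < n -> par j < j.
Proof.
move=> bj jN; have [l [t [-> lA tr]]] := leg_ix bj jN.
rewrite par_leg //; case: t tr => [|t] tr; last by nlia.
by case: ifP => _; [have := ltn_ord x0|have := ltn_ord y0]; nlia.
Qed.

Let adj_phi_below i j : i < j -> j < n ->
  adj E (phi i) (phi j) = attach_below b r p e0 x0 y0 i j.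
Proof.
move=> ij jN; rewrite /attach_below ij /=; case: (ltnP j b) => jb.
  have ib := ltn_trans ij jb; rewrite (phi_base (Ordinal ib)) (phi_base (Ordinal jb)).
  by rewrite adjg /e0 /nat_adj !insubT.
have pj := par_lt jb jN; have [l [t [jE lA tr]]] := leg_ix jb jN.
have par_adj : adj E (phi (par j)) (phi j).
  rewrite -(dist1E tE) jE phi_par // phi_leg //; case: t tr {jE} => [|t] tr.
    by rewrite (leg_first legs) // nthA.
  by rewrite (leg_next legs) // nthA.
rewrite -/par; apply/idP/eqP => [|->]; last exact: par_adj.
rewrite -(dist1E tE) {1}jE phi_leg // => /eqP/(leg_nbr legs (nthA lA) tr)[e|[tr' e]].
  apply: phi_inj; rewrite ?(ltn_trans ij) ?(ltn_trans pj) // jE phi_par //.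
have jN' : j.+1 < n.
  have : r * l.+1 <= r * #|A| by rewrite leq_mul2l lA orbT.
  by rewrite jE mulnS; move: nE; nlia.
move: e; rewrite -phi_leg // addnS -jE => /phi_inj-/(_ (ltn_trans ij jN) jN').
nlia.
Qed.

Theorem attach_iso : graph_iso (attach n b r p e0 x0 y0) E.
Proof.
have sE : simple_graph E by case/and3P: tE.
apply: (@graph_isoI _ _ _ (fun i : 'I_n => phi i)) => //.
- exact: simple_attach.
- by move=> i j /phi_inj e; apply: val_inj; apply: e.
move=> i j; rewrite adj_attach; case: (ltngtP i j) => [ij|ji|/val_inj ->].
- by rewrite adj_phi_below // [X in _ || X]/attach_below ltnNge ltnW // orbF.
- by rewrite adjC adj_phi_below // [X in X || _]/attach_below ltnNge ltnW.
- by rewrite adj_irr // /attach_below ltnn.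
Qed.

End Gluing.

(** * Double brooms *)

(** With a suitable height [f], this shows that the ends of two legs are far. *)
Lemma lipschitz_dist (T : finType) (E : {set {set T}}) (f : T -> nat) x y :
    is_tree E -> (forall x y, adj E x y -> f x <= (f y).+1) ->
  f x <= f y + dist E x y.
Proof.
move=> tE lip; have [p [<- pp <-]] := dist_path (tree_connect tE x y).
elim: p x pp => [|z p IHp] x /=; first by rewrite addn0.
by case/andP=> /lip xz /IHp; lia.
Qed.

Lemma card_le_nat n K (S : {set 'I_n}) (f : nat -> nat) :
  (forall x : 'I_n, x \in S -> exists2 i, i < K & val x = f i) -> #|S| <= K.
Proof.
move=> cov; rewrite -(card_imset S (@Some_inj _)).
rewrite -[X in _ <= X]card_ord.
apply: leq_trans (leq_imset_card (fun i : 'I_K => insub (f i)) predT).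
apply: subset_leq_card; apply/subsetP => _ /imsetP[x xS ->].
have [i iK e] := cov x xS; apply/imsetP; exists (Ordinal iK) => //.
by rewrite /= -e valK.
Qed.

Lemma card_ge_nat n K (S : {set 'I_n}) (f : nat -> nat) :
    (forall i, i < K -> exists2 x : 'I_n, x \in S & val x = f i) ->
    (forall i j, i < K -> j < K -> f i = f j -> i = j) ->
  K <= #|S|.
Proof.
move=> cov inj.
have /fin_all_exists2[h hS hE] (i : 'I_K) := cov i (ltn_ord i).
have hI : injective h.
  move=> i j e; apply/val_inj; apply: inj (ltn_ord i) (ltn_ord j) _.
  by rewrite -!hE e.
rewrite -[K]card_ord -(card_imset _ hI); apply: subset_leq_card.
by apply/subsetP => _ /imsetP[i _ ->].
Qed.

Definition degree (T : finType) (E : {set {set T}}) x := #|[set y | adj E x y]|.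

Section Broom.

Variables (r m s n p : nat).
Hypotheses (r2 : 2 <= r) (s0 : 0 < s) (sr : s < r) (nE : n = s.+1 + r * m).
Hypothesis pm : p <= m.

(** A star on the vertices below [s.+1] with centre 0, with [p] legs at 0 and the
    other [m - p] legs at its leaf 1. *)
Definition double_broom : {set {set 'I_n}} :=
  attach n s.+1 r p (fun i _ => i == 0) 0 1.

Let b := s.+1.
Let par j := if j < b then 0 else attach_parent b r p 0 1 j.

Let adjE (i j : 'I_n) : adj double_broom i j =
  ((i < j) && (i == par j :> nat)) || ((j < i) && (j == par i :> nat)).
Proof.
rewrite adj_attach /attach_below /par.
by congr (_ && _ || _ && _); case: ifP.
Qed.

Let ix i : b <= i -> i < n -> exists l t, [/\ i = b + r * l + t, l < m & t < r].
Proof. by rewrite nE => ? ?; apply: leg_index => //; apply: ltnW. Qed.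

Let par_leg l t : t < r -> par (b + r * l + t) =
  if t is t'.+1 then b + r * l + t' else if l < p then 0 else 1.
Proof. by move=> tr; rewrite /par ifN ?attach_parent_leg // -leqNgt -addnA leq_addr. Qed.

Let par_base j : j < b -> par j = 0.
Proof. by rewrite /par => ->. Qed.

Let par_lt j : 0 < j -> j < n -> par j < j.
Proof.
move=> j0 jn; case: (ltnP j b) => jb; first by rewrite par_base.
have [l [t [-> lm tr]]] := ix jb jn; rewrite par_leg // /b.
by case: t tr => [|t] tr; [case: ifP => _; lia|lia].
Qed.

Let adj_par (i j : 'I_n) : 0 < j -> val i = par j -> adj double_broom i j.
Proof. by move=> j0 e; rewrite adjE e eqxx par_lt. Qed.

Let n0 : 0 < n. Proof. by rewrite nE. Qed.
Let n1 : 1 < n. Proof. by rewrite nE; lia. Qed.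

Let hub0 := Ordinal n0.
Let hub1 := Ordinal n1.

Let sE : simple_graph double_broom. Proof. exact: simple_attach. Qed.

Lemma double_broom_tree : is_tree double_broom.
Proof.
apply/and3P; split=> //.
  rewrite /connected card_ord n0.
  have to0 (j : 'I_n) : connect (adj double_broom) hub0 j.
    have [k] := ubnP (val j); elim: k j => // k IHk j jk.
    case: (posnP j) => [j0|j0].
      by rewrite (_ : j = hub0) ?connect0 //; apply: val_inj.
    have pj := par_lt j0 (ltn_ord j).
    have pn := ltn_trans pj (ltn_ord j).
    apply: connect_trans (IHk (Ordinal pn) _) (connect1 _); first exact: leq_trans pj _.
    exact: adj_par.
  apply/forallP => i; apply/forallP => j; apply: connect_trans (to0 j).
  by rewrite (sym_connect_sym (@adjC _ _)).
apply: (@acyclic_rank _ _ val) => x y z xy xz yx zx.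
have low w : adj double_broom x w -> w <= x -> val w = par x.
  by rewrite adjE; case/orP => /andP[] => [|_ /eqP //]; lia.
by apply: val_inj; rewrite /= (low y) // (low z).
Qed.

Let tE := double_broom_tree.
Let dT := tree_metric_dist tE.
Let dist := dist double_broom.
Let d0 x : dist x x = 0. Proof. exact: dxx dT x. Qed.
Let dC x y : dist x y = dist y x. Proof. exact: tm_sym dT x y. Qed.
Let tri x y z : dist x z <= dist x y + dist y z. Proof. exact: tm_tri dT x y z. Qed.

Let dist_par (i j : 'I_n) : 0 < j -> val i = par j -> dist i j = 1.
Proof. by move=> j0 e; apply/eqP; rewrite (dist1E tE) adj_par. Qed.

Let dist_base (j : 'I_n) : j < b -> dist hub0 j <= 1.
Proof.
move=> jb; case: (posnP j) => [j0|j0].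
  by rewrite (_ : j = hub0) ?d0 //; apply: val_inj.
by rewrite dist_par ?par_base.
Qed.

Let dist_leg l t (j : 'I_n) : l < m -> t < r -> val j = b + r * l + t ->
  dist (if l < p then hub0 else hub1) j <= t.+1.
Proof.
move=> lm; elim: t j => [|t IHt] j tr jE.
  have j0 : 0 < j by rewrite jE.
  rewrite dist_par // jE par_leg //; by case: ifP.
have j0 : 0 < j by rewrite jE.
have jn : b + r * l + t < n by rewrite (leq_trans _ (ltn_ord j)) // jE; lia.
apply: leq_trans (tri _ (Ordinal jn) _) _; rewrite -(addn1 t.+1) leq_add //.
  by apply: IHt => //; apply: ltnW.
by rewrite dist_par // jE par_leg.
Qed.

Let is_end (j : nat) := [exists l : 'I_m, j == b + r * l + r.-1].
Let ends : {set 'I_n} := [set j : 'I_n | is_end j].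

Let shallow (j : 'I_n) : j \notin ends ->
  exists2 h, h \in [set hub0; hub1] & dist h j <= r.-1.
Proof.
move=> jD; case: (ltnP j b) => jb.
  exists hub0; first exact: set21.
  by apply: leq_trans (dist_base jb) _; lia.
have [l [t [jE lm tr]]] := ix jb (ltn_ord j).
exists (if l < p then hub0 else hub1); first by case: ifP => _; rewrite !inE eqxx ?orbT.
apply: leq_trans (dist_leg lm tr jE) _.
suff : t != r.-1 by lia.
apply: contra jD => /eqP tE'; rewrite inE; apply/existsP; exists (Ordinal lm).
by rewrite jE tE'.
Qed.

Let hubs_close : {in [set hub0; hub1] &, forall h h', dist h h' <= 1}.
Proof.
have h01 : dist hub0 hub1 <= 1 by apply: dist_base; rewrite /b /=; lia.
move=> h h' /set2P[] -> /set2P[] ->; rewrite ?d0 //.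
by rewrite dC.
Qed.

(** The function [f] increases along leg [l], decreases along leg [l'], and is
    constant elsewhere; it takes the values [r + r] and 0 at their ends. *)
Let ends_indep : indep (far dist r) ends.
Proof.
apply/indepP => i j; rewrite !inE => /existsP[l /eqP iE] /existsP[l' /eqP jE] ij.
have ll' : l != l' :> nat.
  apply: contraNneq ij => e; apply/eqP/val_inj; rewrite /= iE jE.
  by move: e => ->.
pose f (x : nat) := if x < b then r else
  if (x - b) %/ r == l then r + ((x - b) %% r).+1 else
  if (x - b) %/ r == l' then r - ((x - b) %% r).+1 else r.
have f_leg k t : t < r -> f (b + r * k + t) =
    if k == l then r + t.+1 else if k == l' then r - t.+1 else r.
  move=> tr; rewrite /f ifN; last by rewrite -leqNgt -addnA leq_addr.
  have -> : b + r * k + t - b = k * r + t by lia.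
  by rewrite divnMDl ?modnMDl ?(leq_trans _ tr) // divn_small // modn_small // addn0.
have f_par x : 0 < x -> x < n -> f x <= (f (par x)).+1 /\ f (par x) <= (f x).+1.
  move=> x0 xn; case: (ltnP x b) => xb; first by rewrite par_base // /f xb /=.
  have [k [t [-> km tr]]] := ix xb xn; rewrite par_leg // f_leg //.
  case: t tr => [|t] tr.
    have -> : f (if k < p then 0 else 1) = r.
      by case: (k < p); rewrite /f /b ?ltnS ?s0.
    by case: ifP => _; [|case: ifP => _]; lia.
  by rewrite f_leg ?(ltnW tr) //; case: ifP => _; [|case: ifP => _]; lia.
have := @lipschitz_dist _ _ (fun x : 'I_n => f x) i j tE.
rewrite iE jE !f_leg ?ltn_predL ?(ltnW r2) // eqxx ifN 1?eq_sym // eqxx.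
rewrite /far => h; have : forall x y : 'I_n, adj double_broom x y -> f x <= (f y).+1.
  move=> x y; rewrite adjE => /orP[] /andP[xy /eqP ->].
    by have [] := f_par y (leq_ltn_trans (leq0n _) xy) (ltn_ord y).
  by have [] := f_par x (leq_ltn_trans (leq0n _) xy) (ltn_ord x).
by move/h; rewrite prednK ?(ltnW r2) // subnn.
Qed.

Let card_ends : #|ends| = m.
Proof.
apply/eqP; rewrite eqn_leq; apply/andP; split.
  apply: (@card_le_nat _ _ _ (fun l => b + r * l + r.-1)) => x.
  by rewrite inE => /existsP[l /eqP e]; exists l.
apply: (@card_ge_nat _ _ _ (fun l => b + r * l + r.-1)) => [l lm|l l' lm l'm].
  have xn : b + r * l + r.-1 < n.
    have : r * l.+1 <= r * m by rewrite leq_mul2l lm orbT.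
    by rewrite nE /b mulnS; lia.
  by exists (Ordinal xn) => //; rewrite inE; apply/existsP; exists (Ordinal lm).
move/eqP; rewrite eqn_add2r eqn_add2l eqn_pmul2l; last exact: ltnW.
by move/eqP.
Qed.

(** Vertices that are not ends of legs are within [r.-1] of one of the two adjacent
    hubs, hence never far from each other. *)
Lemma double_broom_num_mdis k : k.+1 = r + r ->
  num_mdis k double_broom <= min_mis r n.
Proof.
move=> kr; rewrite (num_mdisE tE kr).
have close : {in ~: ends &, forall x y, ~~ far dist r x y}.
  move=> x y; rewrite !inE => /negP xD /negP yD.
  have [|h hh hx] := @shallow x; first by rewrite inE; apply/negP.
  have [|h' hh' h'y] := @shallow y; first by rewrite inE; apply/negP.
  have := hubs_close hh hh'; have := tri x h y; have := tri h h' y.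
  by rewrite /far (dC x h) -ltnNge; nlia.
have := card_mis_le_compl (farC dT r) ends_indep close.
rewrite card_ord => /(_ n0); rewrite card_ends -card_gt0 card_ends.
have q : n.-1 %/ r = m.
  by rewrite nE addSn /= addnC mulnC divnMDl ?divn_small ?addn0 //; lia.
rewrite /min_mis q.
have -> : (r < n) = (0 < m).
  rewrite nE; case: m => [|m']; first by rewrite muln0; lia.
  by rewrite mulnS; lia.
move: (#|_|); clear; lia.
Qed.

(** The neighbours of vertex 0: the other vertices of the star, and the first
    vertices of the legs that hang at 0. *)
Let hub_nbr i := if i < s then i.+1 else b + r * (i - s).

Let hub_nbr_inj i j : hub_nbr i = hub_nbr j -> i = j.
Proof.
have big l : s < b + r * l by rewrite /b addSn ltnS leq_addr.
rewrite /hub_nbr; case: ltnP => hi; case: ltnP => hj.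
- by case.
- by move=> e; have := big (j - s); rewrite -e ltnNge hi.
- by move=> e; have := big (i - s); rewrite e ltnNge hj.
move/eqP; rewrite eqn_add2l eqn_pmul2l ?(ltnW r2) // => /eqP e.
by rewrite -(subnKC hi) e subnKC.
Qed.

Lemma double_broom_hub : exists x, s + p <= degree double_broom x.
Proof.
exists hub0; apply: (card_ge_nat (f := hub_nbr)) => [i ip|i j _ _ /hub_nbr_inj//].
have fn : hub_nbr i < n.
  rewrite /hub_nbr; case: ifP => hi; first by rewrite nE; lia.
  have : r * (i - s).+1 <= r * m by rewrite leq_mul2l orbC; apply/orP; left; lia.
  by rewrite nE mulnS /b; lia.
exists (Ordinal fn) => //; rewrite inE; apply: adj_par => /=.
  by rewrite /hub_nbr /b; case: ifP.
rewrite /hub_nbr; case: ifP => hi; first by rewrite par_base // /b ltnS.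
by rewrite -[b + _]addn0 par_leg ?(ltnW r2) // ifT //; lia.
Qed.

(** The vertex 1 has [1 + (m - p)] neighbours, which is where [m <= p.*2] is used,
    and the vertices other than 0 and 1 have at most two. *)
Lemma double_broom_degree x : 0 < m -> m <= p.*2 -> degree double_broom x <= s + p.
Proof.
move=> m0 mp; have child (y : 'I_n) : x < y -> x = par y :> nat ->
    [\/ b <= x /\ y = x.+1 :> nat,
        x = 0 :> nat /\ (y < b \/ exists2 l, l < p & y = b + r * l :> nat) |
        x = 1 :> nat /\ exists2 l, p <= l < m & y = b + r * l :> nat].
  move=> xy; case: (ltnP y b) => yb; first by rewrite par_base // => x0; constructor 2; auto.
  have [l [t [yE lm tr]]] := ix yb (ltn_ord y).
  rewrite yE par_leg //; case: t tr yE => [|t] tr.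
    rewrite addn0 => yE; case: ltnP => lp ->; [constructor 2|constructor 3].
      by split=> //; right; exists l.
    by split=> //; exists l; rewrite ?lp.
  by move=> _ ->; constructor 1; rewrite addnS -addnA leq_addr.
have nbr y : y \in [set y | adj double_broom x y] ->
    (x < y /\ x = par y :> nat) \/ (y < x /\ y = par x :> nat).
  by rewrite inE adjE => /orP[] /andP[? /eqP ?]; [left|right].
case x0 : (x : nat) => [|x'].
  apply: (card_le_nat (f := hub_nbr)) => y /nbr[[xy /(child _ xy)]|[]]; last by rewrite x0.
  rewrite x0; case=> [[//]|[_ []]|[//]].
    move=> yb; have y0 : 0 < y by move: xy; rewrite x0.
    have ys : y.-1 < s by rewrite -ltnS prednK.
    by exists y.-1; [apply: leq_trans ys (leq_addr _ _)|rewrite /hub_nbr ys prednK].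
  case=> l lp yE; exists (s + l); first by rewrite ltn_add2l.
  by rewrite /= yE /hub_nbr ltnNge leq_addr /= addKn.
case: x' x0 => [|x'] x1.
  apply: leq_trans (_ : 1 + (m - p) <= _); last by lia.
  apply: (card_le_nat (f := fun i => if i is i'.+1 then b + r * (p + i') else 0)) => y.
  case/nbr => [[xy /(child _ xy)]|[yx _]]; last by exists 0 => //; move: yx; rewrite x1 /=; lia.
  rewrite x1; case=> [[]|[//]|[_ [l /andP[pl lm] yE]]]; first by rewrite /b; lia.
  by exists (l - p).+1; [lia|rewrite subnKC].
apply: leq_trans (_ : 2 <= _); last by lia.
apply: (card_le_nat (f := fun i => if i == 0 then par x else x.+1)) => y.
case/nbr => [[xy /(child _ xy)]|[_ yE]]; last by exists 0; rewrite //= yE.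
by rewrite x1; case=> [[_ yE]|[//]|[//]]; exists 1; rewrite //= yE.
Qed.

End Broom.

(** * The number of trees grows with the number of vertices *)

(** Otherwise the edges from [x] to [y] and to [z] would both begin a shortest path
    to [v], although each of them is a bridge. *)
Lemma closer_neighbour_unique (V : finType) (d : V -> V -> nat) v x y z :
    tree_metric d -> d x y = 1 -> d x z = 1 -> d y v <= d x v -> d z v <= d x v ->
  y = z.
Proof.
move=> dT xy xz yv zv; have dC := tm_sym dT.
have yx : d y x = 1 by rewrite dC.
have vyx : d v x = (d v y).+1.
  by have := tm_step dT v xy; rewrite (dC v x) (dC v y); lia.
have vzx : d v x = (d v z).+1.
  by have := tm_step dT v xz; rewrite (dC v x) (dC v z); lia.
have [zyx|zxy] := tm_step dT z yx.
  by apply/esym/(d0_eq dT); move: zyx; rewrite (dC z x) xz; lia.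
by have := tm_bridge dT yx vyx zxy; rewrite xz; lia.
Qed.

Section Pendant.

Variable m : nat.
Implicit Types (E F : {set {set 'I_m}}) (v w : 'I_m).

Let new : 'I_m.+1 := ord_max.
Let old : 'I_m -> 'I_m.+1 := lift ord_max.

Definition pendant_rel E v : rel 'I_m.+1 := fun x y =>
  match unlift ord_max x, unlift ord_max y with
  | Some x', Some y' => adj E x' y'
  | Some x', None => x' == v
  | None, Some y' => y' == v
  | None, None => false
  end.

(** A new leaf attached at [v].  If [v] has maximum degree in [E], it is the only
    vertex of maximum degree in the new graph, which thus remembers [v]. *)
Definition pendant E v : {set {set 'I_m.+1}} := edges_of (pendant_rel E v).

Let adjE E v x y : adj (pendant E v) x y = pendant_rel E v x y.
Proof.
rewrite adj_edges_of // => {}x {}y; rewrite /pendant_rel.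
by case: (unlift _ x) => [x'|]; case: (unlift _ y) => [y'|] //; rewrite adjC.
Qed.

Let adj_old E v x y : adj (pendant E v) (old x) (old y) = adj E x y.
Proof. by rewrite adjE /pendant_rel !liftK. Qed.

Let adj_new E v y : adj (pendant E v) new y = (y == old v).
Proof.
rewrite adjE /pendant_rel unlift_none; case: unliftP => [y' ->|->].
  by rewrite (inj_eq lift_inj).
by rewrite (negPf (neq_lift _ _)).
Qed.

Let ord_cases (x : 'I_m.+1) : x = new \/ exists x', x = old x'.
Proof. by case: (unliftP ord_max x) => [x' ->|->]; [right; exists x'|left]. Qed.

Lemma simple_pendant E v : simple_graph E -> simple_graph (pendant E v).
Proof.
move=> sE; apply: simple_edges_of => x; rewrite /pendant_rel.
by case: (unlift _ x) => // x'; apply: adj_irr.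
Qed.

Lemma pendant_tree E v : is_tree E -> is_tree (pendant E v).
Proof.
move=> tE; have sE : simple_graph E by case/and3P: tE.
have dT := tree_metric_dist tE.
apply/and3P; split; first exact: simple_pendant.
  rewrite /connected card_ord /=.
  have toold x : connect (adj (pendant E v)) (old v) (old x).
    have /connectP[p pp ->] := tree_connect tE v x; apply/connectP.
    exists (map old p); last by rewrite last_map.
    by rewrite path_map (eq_path (e' := adj E)) // => a b; apply: adj_old.
  have to x : connect (adj (pendant E v)) (old v) x.
    have [->|[x' ->]] := ord_cases x; last exact: toold.
    by apply: connect1; rewrite adjC adj_new.
  apply/forallP => x; apply/forallP => y; apply: connect_trans (to y).
  by rewrite (sym_connect_sym (@adjC _ _)).
(* Rank by the distance to v; the rank of the new leaf only has to exceed that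
   of v, its single neighbour. *)
pose rk x := if unlift ord_max x is Some x' then dist E x' v else 1.
have rk_old x : rk (old x) = dist E x v by rewrite /rk liftK.
apply: (@acyclic_rank _ _ rk) => x y z.
have [->|[x' ->]] := ord_cases x; first by rewrite !adj_new => /eqP-> /eqP->.
have not_new : adj (pendant E v) (old x') new -> rk new <= rk (old x') -> False.
  rewrite adjC adj_new => /eqP ->.
  by rewrite rk_old (dxx dT) /rk unlift_none.
have [->|[y' ->]] := ord_cases y; first by move=> /not_new h _ /h.
have [->|[z' ->]] := ord_cases z; first by move=> _ /not_new h _ /h.
rewrite !adj_old !rk_old -!(dist1E tE) => /eqP xy /eqP xz yv zv.
by rewrite (closer_neighbour_unique dT xy xz yv zv).
Qed.

Let deg_old E v x : degree (pendant E v) (old x) = degree E x + (x == v).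
Proof.
rewrite /degree (cardsD1 new) inE adjC adj_new (inj_eq lift_inj) addnC.
congr (_ + _); rewrite -(card_imset (mem [set y | adj E x y]) (@lift_inj _ ord_max)).
apply: eq_card => y; rewrite !inE; apply/andP/imsetP => [[yn]|[y' + ->]].
  have [yE|[y' ->]] := ord_cases y; first by rewrite yE eqxx in yn.
  by rewrite adj_old => xy; exists y'; rewrite ?inE.
by rewrite inE adj_old eq_sym neq_lift.
Qed.

Let deg_new E v : degree (pendant E v) new = 1.
Proof.
rewrite /degree -(cards1 (old v)); apply: eq_card => y.
by rewrite !inE adj_new.
Qed.

Lemma degree_perm (T : finType) (E F : {set {set T}}) (s : {perm T}) x :
  (forall x y, adj F (s x) (s y) = adj E x y) -> degree F (s x) = degree E x.
Proof.
move=> h; rewrite /degree -(card_imset (mem [set y | adj E x y]) (@perm_inj _ s)).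
apply: eq_card => y; rewrite !inE -[y](permKV s) h mem_imset ?inE //.
exact: perm_inj.
Qed.

(** An isomorphism maps [v] to [w], the only vertices of maximum degree.  The image
    of the new leaf is a leaf at [w], and exchanging it with the new leaf at [w]
    gives an isomorphism that restricts to the old vertices. *)
Lemma pendant_iso E F v w :
    simple_graph E -> simple_graph F -> 0 < degree F w ->
    (forall x, degree E x <= degree E v) -> (forall x, degree F x <= degree F w) ->
  graph_iso (pendant E v) (pendant F w) -> graph_iso E F.
Proof.
move=> sE sF w0 vmax wmax.
case/graph_isoP; rewrite ?simple_pendant // => s hs.
have deg_le y : degree (pendant E v) y <= (degree E v).+1.
  have [->|[x ->]] := ord_cases y; first by rewrite deg_new.
  by rewrite deg_old -addn1 leq_add // leq_b1.
have deg_max y : degree (pendant F w) y = (degree F w).+1 -> y = old w.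
  have [->|[x ->]] := ord_cases y; first by rewrite deg_new => -[e]; rewrite -e in w0.
  by rewrite deg_old; case: eqP => [->//|_]; have := wmax x; lia.
have sv : s (old v) = old w.
  apply: deg_max; rewrite (degree_perm _ hs).
  apply/eqP; rewrite eqn_leq deg_old eqxx addn1 ltnS; apply/andP; split.
    have := degree_perm (old v) hs; rewrite deg_old eqxx addn1.
    have [->|[x ->]] := ord_cases (s (old v)); first by rewrite deg_new => -[<-].
    by rewrite deg_old; have := wmax x; case: eqP; lia.
  have := degree_perm ((s^-1)%g (old w)) hs; rewrite permKV deg_old eqxx addn1.
  by have := deg_le ((s^-1)%g (old w)); lia.
have adj_snew z : adj (pendant F w) (s new) z = adj (pendant F w) new z.
  by rewrite -[z](permKV s) hs !adj_new -sv (inj_eq perm_inj).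
(* Both new and s new are leaves at old w, hence interchangeable. *)
pose t x := if s (old x) == new then s new else s (old x).
have tN x : t x != new.
  rewrite /t; case: (s (old x) =P new) => [e|/eqP//]; apply/eqP => h.
  by have /perm_inj/eqP := etrans h (esym e); rewrite (negPf (neq_lift _ _)).
have adj_t x z : adj (pendant F w) (t x) z = adj (pendant F w) (s (old x)) z.
  by rewrite /t; case: eqP => // ->; apply: adj_snew.
have [f fE] : exists f : 'I_m -> 'I_m, forall x, old (f x) = t x.
  suff /fin_all_exists[f fE] : forall x, exists y, old y = t x by exists f.
  move=> x; have [e|[y e]] := ord_cases (t x); last by exists y.
  by have := tN x; rewrite e eqxx.
apply: (@graph_isoI _ _ _ f) => // [x y fxy|x y].
  have : t x = t y by rewrite -!fE fxy.
  have noold z : s new = s (old z) -> x = y.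
    by move/perm_inj/eqP; rewrite (negPf (neq_lift _ _)).
  rewrite /t; case: eqP => [ex|_]; case: eqP => [ey|_].
  - by move=> _; apply/(@lift_inj _ ord_max)/(@perm_inj _ s); rewrite ex ey.
  - exact: noold.
  - by move/esym/noold.
  - by move/perm_inj/lift_inj.
by rewrite -(adj_old F w) !fE adj_t adjC adj_t adjC hs adj_old.
Qed.

End Pendant.

Lemma simple_trees (T : finType) :
  {in [set E : {set {set T}} | is_tree E], forall E, simple_graph E}.
Proof. by move=> E; rewrite inE => /and3P[]. Qed.

Lemma max_degree_vertex m (E : {set {set 'I_m}}) : 1 < m -> is_tree E ->
  exists v, 0 < degree E v /\ forall x, degree E x <= degree E v.
Proof.
move=> m1 tE; pose i0 := Ordinal (ltnW m1); pose i1 := Ordinal m1.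
case: (@arg_maxnP _ i0 predT (degree E) isT) => v _ vmax.
exists v; split=> [|x]; last exact: vmax.
apply: leq_trans (vmax i0 isT).
have /connectP[[|y p]] := tree_connect tE i0 i1; first by move=> _ /(congr1 val).
by case/andP=> xy _ _; apply/card_gt0P; exists y; rewrite inE.
Qed.

(** Attaching a leaf at a vertex of maximum degree is injective on classes. *)
Lemma num_trees_leS m : 1 < m -> num_trees m <= num_trees m.+1.
Proof.
move=> m1; have [R [RA Rle Rcov]] := iso_representatives (@simple_trees 'I_m.+1).
apply: leq_trans Rle.
pose good (G : {set {set 'I_m.+1}}) (E : {set {set 'I_m}}) := [&& is_tree E & [exists v, [&& 0 < degree E v,
   [forall x, degree E x <= degree E v] & graph_iso G (pendant E v)]]].
pose g (G : {set {set 'I_m.+1}}) : {set {set 'I_m}} := odflt set0 [pick E | good G E].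
have sg G : simple_graph (g G).
  rewrite /g; case: pickP => [E /andP[/and3P[]]//|_].
  by apply/forall_inP => e; rewrite inE.
apply: (num_iso_classes_le (@simple_trees _) sg) => E; rewrite inE => tE.
have [v [v0 vmax]] := max_degree_vertex m1 tE.
have sE : simple_graph E by case/and3P: tE.
have [|G GR GE] := Rcov (pendant E v); first by rewrite inE pendant_tree.
exists G => //; have sG : simple_graph G by apply: simple_trees (subsetP RA _ GR).
rewrite /g; case: pickP => [F|/(_ E)]; last first.
  rewrite /good tE /= => /existsP[]; exists v; rewrite v0 GE andbT.
  exact/forallP.
case/andP=> /and3P[sF _ _] /existsP[w /and3P[w0 /forallP wmax GF]] /=.
apply: (pendant_iso sF sE v0 wmax vmax).
apply: graph_iso_trans GE; rewrite ?simple_pendant //.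
by apply: graph_iso_sym; rewrite ?simple_pendant.
Qed.

Lemma num_trees_le m m' : 1 < m -> m <= m' -> num_trees m <= num_trees m'.
Proof.
move=> m1 /subnK <-; elim: (m' - m) => // i IHi.
by apply: leq_trans IHi (num_trees_leS _); lia.
Qed.

(** * Counting the minimal trees *)

Section Counting.

Variables (k r m s n : nat).
Hypotheses (kr : k.+1 = r + r) (r2 : 2 <= r).
Hypotheses (nE : n = s.+1 + r * m) (s0 : 0 < s) (sr : s < r).

Let broom p := double_broom r s n p.

Lemma k_minimal_broom p : p <= m -> k_minimal k (broom p).
Proof.
move=> pm; apply/andP; split; first exact: double_broom_tree nE pm.
apply/forallP => F; apply/implyP => tF.
apply: leq_trans (double_broom_num_mdis r2 s0 sr nE pm kr) _.
by have := num_mdis_ge tF r2 kr; rewrite card_ord.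
Qed.

Lemma k_minimal_mis (E : {set {set 'I_n}}) : k_minimal k E -> num_mdis k E <= min_mis r n.
Proof.
case/andP=> _ /forallP/(_ (broom 0))/implyP h.
apply: leq_trans (h _) _; first exact: double_broom_tree nE (leq0n m).
by rewrite /broom (double_broom_num_mdis r2 s0 sr nE _ kr).
Qed.

(** The maximum degree of the first broom is at most [s + p], and the second one has
    a vertex of degree at least [s + p']. *)
Lemma broom_iso_le p p' : 0 < m -> m <= p.*2 -> p <= m -> p' <= m ->
  graph_iso (broom p) (broom p') -> p' <= p.
Proof.
move=> m0 mp pm p'm; rewrite /broom => iso.
have [x] := double_broom_hub r2 s0 sr nE p'm.
have sb q : simple_graph (double_broom r s n q) by apply: simple_attach.
case/(graph_isoP (sb _) (sb _)): iso => t ht.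
rewrite -(permKV t x) (degree_perm _ ht) => h.
have := leq_trans h (double_broom_degree r2 s0 sr nE pm ((t^-1)%g x) m0 mp).
by rewrite leq_add2l.
Qed.

Lemma simple_k_minimal :
  {in [set E : {set {set 'I_n}} | k_minimal k E], forall E, simple_graph E}.
Proof. by move=> E; rewrite inE => /andP[/and3P[]]. Qed.

Lemma num_k_minimal_ge : m./2.+1 <= num_k_minimal_trees k n.
Proof.
rewrite -[m./2.+1]card_ord.
(* These values p satisfy m <= p.*2, so that s + p is the maximum degree. *)
have pm (i : 'I_m./2.+1) : uphalf m + i <= m.
  by have := ltn_ord i; rewrite ltnS uphalf_half; have := odd_double_half m; lia.
rewrite /num_k_minimal_trees; apply: (@num_iso_classes_ge _ _ simple_k_minimal _ (fun i : 'I_m./2.+1 => broom (uphalf m + i))).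
  by move=> i; rewrite inE k_minimal_broom.
have le i j : graph_iso (broom (uphalf m + i)) (broom (uphalf m + j)) ->
    i <= m./2 -> j <= m./2 -> j <= i.
  move=> iso im jm; case: (posnP m) => [m0|m0]; first by rewrite m0 in im jm; lia.
  rewrite -(leq_add2l (uphalf m)); apply: broom_iso_le iso => //; try lia.
move=> i j iso; have im : i <= m./2 by rewrite -ltnS ltn_ord.
have jm : j <= m./2 by rewrite -ltnS ltn_ord.
have sb p : simple_graph (broom p) by apply: simple_attach.
have iso' := graph_iso_sym (sb _) (sb _) iso.
have ji : j <= i by apply: (le i j).
have ij : i <= j by apply: (le j i).
by apply: val_inj; apply/eqP; rewrite eqn_leq ij ji.
Qed.

Lemma head_last_set (T : finType) (x y : T) (z : T) :
  [set head z (enum [set x; y]); last z (enum [set x; y])] = [set x; y].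
Proof.
have : size (enum [set x; y]) <= 2 by rewrite -cardE cards2; case: eqP.
have mE w : w \in enum [set x; y] = (w \in [set x; y]) by rewrite mem_enum.
case E : (enum [set x; y]) mE => [|a [|b [|c l]]] mE // _.
- by have := mE x; rewrite set21.
- by apply/setP => w; rewrite -mE !inE orbb.
- by apply/setP => w; rewrite -mE !inE.
Qed.

Section Large.

Hypothesis m2 : 2 <= m.

Let L := m - s - 2.
Let b := n - r * L.

Let rL : r * L <= r * m.
Proof. by rewrite leq_mul2l /L -subnDA leq_subr orbT. Qed.

Let b2 : 1 < b.
Proof. by rewrite /b; move: rL; rewrite nE; nlia. Qed.

Let i0 : 'I_b := Ordinal (ltnW b2).

Let first_hub (E0 : {set {set 'I_b}}) := head i0 (enum (centre (dist E0) r setT)).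
Let last_hub (E0 : {set {set 'I_b}}) := last i0 (enum (centre (dist E0) r setT)).

(** These graphs meet all classes of minimal trees: [c.1] stands for the base, up to
    isomorphism, and [c.2] is the number of legs to put back at its first hub. *)
Let code (c : {set {set 'I_b}} * 'I_L.+1) : {set {set 'I_n}} :=
  attach n b r c.2 (nat_adj c.1) (first_hub c.1) (last_hub c.1).

(** The isomorphism between the base and its representative maps centre to centre,
    so the first and the last hub of the representative are the hubs of the
    tree, in an order that only depends on the representative. *)
Lemma num_k_minimal_le_base : num_k_minimal_trees k n <= num_trees b * L.+1.
Proof.
have [R [RA Rle Rcov]] := iso_representatives (@simple_trees 'I_b).
pose C := setX R [set: 'I_L.+1].
apply: leq_trans (_ : #|C| <= _); last first.
  by rewrite /C cardsX cardsT card_ord leq_mul2r Rle orbT.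
rewrite /num_k_minimal_trees; apply: (num_iso_classes_le simple_k_minimal (g := code)).
  by move=> c; apply: simple_attach.
move=> E; rewrite inE => kE; have tE : is_tree E by case/andP: kE.
have dT := tree_metric_dist tE.
have Vn : #|'I_n| = (m * r + s).+1 by rewrite card_ord nE addSn addnC mulnC.
have Vmin : #|mis (far (dist E) r) setT| <= min_mis r #|'I_n|.
  by rewrite card_ord -(num_mdisE tE kr) k_minimal_mis.
have [X [A [root [leg [u [v [cX legs AL rootA ctr]]]]]]] :=
  minimal_decomposition dT r2 Vn sr m2 s0 Vmin.
have Xb : #|X| = b.
  by have := leg_card legs; rewrite AL card_ord -/L => e; rewrite /b -[in RHS]e addnK.
pose h (i : 'I_b) : 'I_n := enum_val (cast_ord (esym Xb) i).
have hI : injective h by move=> i j /enum_val_inj/cast_ord_inj.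
have hX : [set h i | i : 'I_b] = X.
  apply/eqP; rewrite eqEcard card_imset // card_ord Xb leqnn andbT.
  by apply/subsetP => _ /imsetP[i _ ->]; apply: enum_valP.
pose EX := edges_of (fun i j : 'I_b => adj E (h i) (h j)).
have adjEX i j : adj EX i j = adj E (h i) (h j).
  by rewrite adj_edges_of // => ? ?; rewrite adjC.
have sE : simple_graph E by case/and3P: tE.
have sEX : simple_graph EX by apply: simple_edges_of => i; rewrite adj_irr.
have b0 : 0 < #|'I_b| by rewrite card_ord ltnW.
have tEX : is_tree EX.
  apply: (pullback_tree tE sEX hI) b0; first by move=> i j; rewrite adjEX.
  by rewrite hX.
have [|E0 E0R iso] := Rcov EX; first by rewrite inE.
have tE0 : is_tree E0 by have := subsetP RA _ E0R; rewrite inE.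
have sE0 : simple_graph E0 by case/and3P: tE0.
case/(graph_isoP sE0 sEX): iso => t ht.
pose g i := h (t i).
have gI : injective g by move=> i j /hI/perm_inj.
have gX : [set g i | i : 'I_b] = X.
  apply/eqP; rewrite eqEcard card_imset // card_ord Xb leqnn andbT -hX.
  by apply/subsetP => _ /imsetP[i _ ->]; apply: imset_f.
have adjg i j : adj E (g i) (g j) = adj E0 i j by rewrite /g -adjEX ht.
have gctr : g @: centre (dist E0) r setT = [set u; v].
  by rewrite -(pullback_centre tE sE0 gI adjg) ?gX.
have hubsE : [set g (first_hub E0); g (last_hub E0)] = [set u; v].
  have [x [y xyE]] : exists x y, centre (dist E0) r setT = [set x; y].
    have : v \in g @: centre (dist E0) r setT by rewrite gctr set22.
    have : u \in g @: centre (dist E0) r setT by rewrite gctr set21.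
    case/imsetP=> x xc ux /imsetP[y yc vy]; exists x, y.
    apply/setP => z; rewrite -(mem_imset _ _ gI) gctr ux vy !inE.
    by rewrite !(inj_eq gI).
  rewrite -gctr /first_hub /last_hub xyE -[in RHS](head_last_set x y i0).
  by rewrite imsetU1 imset_set1.
pose p := #|[set c in A | root c == g (first_hub E0)]|.
have pL : p < L.+1.
  by rewrite ltnS /L -AL; apply: subset_leq_card; apply/subsetP => c; rewrite inE => /andP[].
exists (E0, Ordinal pL); first by rewrite !inE E0R.
have rootg : {in A, forall c, root c \in [set g (first_hub E0); g (last_hub E0)]}.
  by move=> c cA; rewrite hubsE; apply: rootA.
exact: attach_iso tE (ltnW r2) legs gI gX adjg rootg.
Qed.

(** The base has at most [(s + 2) * r + s.+1 <= r * r + 2 * r] vertices, and this is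
    at most [(2 * r - 1) ^ 2] for [r >= 2]. *)
Lemma base_size_le : b <= k ^ 2.
Proof.
have k2 : k ^ 2 + 2 * (r + r) = (r + r) * (r + r) + 1.
  by rewrite -kr -mulnn; lia.
have bE : b <= (s + 2) * r + s.+1.
  rewrite /b nE /L; case: (leqP m (s + 2)) => ms.
    rewrite -subnDA (_ : m - (s + 2) = 0) ?muln0; last by lia.
    rewrite subn0 addnC leq_add2r mulnC leq_mul2r; lia.
  rewrite -subnDA mulnBr; have : r * (s + 2) <= r * m by rewrite leq_mul2l ltnW ?orbT.
  by rewrite [(s + 2) * r]mulnC; lia.
have : (s + 2) * r <= r.+1 * r by rewrite leq_mul2r; lia.
have : 2 * r <= r * r by rewrite leq_mul2r r2 orbT.
move: k2 bE; rewrite mulnDl mulnDr mulSn; nlia.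
Qed.

End Large.

(** For [m <= 1] there are at most [k ^ 2] vertices, and all trees are counted. *)
Lemma num_k_minimal_le : 1 < n -> num_k_minimal_trees k n <= num_trees (k ^ 2) * n.
Proof.
move=> n1; case: (leqP m 1) => m2.
  apply: leq_trans (_ : num_trees (k ^ 2) <= _); last by rewrite leq_pmulr // ltnW.
  apply: leq_trans (_ : num_trees n <= _); last first.
    apply: num_trees_le => //.
    have k2 : k ^ 2 + 2 * (r + r) = (r + r) * (r + r) + 1.
      by rewrite -kr -mulnn; lia.
    have : r * m <= r * 1 by rewrite leq_mul2l m2 orbT.
    have : 2 * r <= r * r by rewrite leq_mul2r r2 orbT.
    by move: k2; rewrite mulnDl mulnDr muln1; nlia.
  have [R [RA Rle Rcov]] := iso_representatives (@simple_trees 'I_n).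
  apply: leq_trans Rle; rewrite /num_k_minimal_trees; apply: (num_iso_classes_le simple_k_minimal (g := fun E => 
    if is_tree E then E else set0)).
    move=> E; case: ifP => [/and3P[]//|_]; by apply/forall_inP => e; rewrite inE.
  move=> E; rewrite inE => /andP[tE _].
  have [|F FR iso] := Rcov E; first by rewrite inE.
  by exists F => //; have := subsetP RA _ FR; rewrite inE => ->.
apply: leq_trans (num_k_minimal_le_base m2) _; apply: leq_mul.
  apply: num_trees_le (base_size_le m2).
  have : r * (m - s - 2) <= r * m by rewrite leq_mul2l -subnDA leq_subr orbT.
  by move: nE s0; nlia.
have : m <= r * m by rewrite leq_pmull // ltnW.
by move: nE; nlia.
Qed.

End Counting.

Unset Implicit Arguments.

Import Order.TTheory GRing.Theory Num.Theory.
Local Open Scope ring_scope.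

Theorem theorem4 (k n : nat) (k_odd : odd k) (k_ge3 : (3 <= k)%N)
    (n_ge4 : (4 <= n)%N) (ndiv : ~~ ((k + 1) %/ 2 %| n - 1)%N) :
  n%:R / (k + 1)%:R <= (num_k_minimal_trees k n)%:R :> rat /\
  (num_k_minimal_trees k n <= num_trees (k ^ 2) * n)%N.
Proof.
set r := ((k + 1) %/ 2)%N in ndiv.
have kr : k.+1 = (r + r)%N.
  have : (2 %| k + 1)%N by rewrite addn1 dvdn2 /= k_odd.
  by move/divnK; rewrite -/r; lia.
have r2 : (2 <= r)%N by lia.
pose m := ((n - 1) %/ r)%N; pose s := ((n - 1) %% r)%N.
have s0 : (0 < s)%N by rewrite lt0n.
have sr : (s < r)%N by rewrite ltn_mod; lia.
have nE : n = (s.+1 + r * m)%N.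
  by have := divn_eq (n - 1) r; rewrite -/m -/s [(r * m)%N]mulnC; nlia.
split; last by apply: (num_k_minimal_le kr r2 nE s0 sr); lia.
have low := num_k_minimal_ge kr r2 nE s0 sr.
rewrite ler_pdivrMr ?ltr0n ?addn1 // -natrM ler_nat kr.
apply: (@leq_trans (m./2.+1 * (r + r))); last by rewrite leq_mul2r low orbT.
have : (m.+1 * r <= (m./2.+1).*2 * r)%N.
  by rewrite leq_mul2r; apply/orP; right; lia.
by rewrite nE mulSn mulnDr -doubleMl -addnn mulnC; nlia.
Qed.
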